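(* Let $\mathcal{P}$ be a connected-hereditary or rooted-hereditary graph property. If the io-restricted maximal $\mathcal{P}$-subgraphs problem can be solved in total polynomial time, then the maximal $\mathcal{P}$-subgraphs problem can be solved in total polynomial time.
   Context: A graph is a triple $G=(V,E,r)$ with $V$ a finite set of vertices, $E\subseteq V\times V$ a set of (directed) edges, and a root $r\in V\cup\{\bot\}$. $G$ is rooted if $r\neq\bot$ and every vertex is reachable from $r$ by a directed path; $G$ is connected if its underlying undirected graph is connected. $H$ is an induced subgraph of $G$, written $H\subseteq_{\mathrm{IS}} G$, if $H$ is obtained from $G$ by deleting some vertices (and incident edges), and the root of $H$ equals the root of $G$ if that root is still a vertex of $H$, and is $\bot$ otherwise; $H\subset_{\mathrm{IS}}G$ means additionally $H\neq G$. $G-v$ is the induced subgraph on all vertices other than $v$. A graph property is a nonempty (possibly infinite) set $\mathcal{P}$ of graphs; throughout, membership in $\mathcal{P}$ is decidable in polynomial time. $\mathcal{P}$ is connected-hereditary if all its graphs are connected and every connected induced subgraph of a graph in $\mathcal{P}$ is in $\mathcal{P}$; it is rooted-hereditary if all its graphs are rooted and every rooted induced subgraph of a graph in $\mathcal{P}$ is in $\mathcal{P}$. A $\mathcal{P}$-subgraph of $G$ is an $H\subseteq_{\mathrm{IS}}G$ with $H\in\mathcal{P}$; it is maximal if no $\mathcal{P}$-subgraph $H'$ of $G$ has $H\subset_{\mathrm{IS}}H'$; $\mathcal{P}^m(G)$ is the set of maximal $\mathcal{P}$-subgraphs and $\mathcal{P}^m(G;v)$ those containing vertex $v$. $G$ almost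 satisfies $\mathcal{P}$ if $G-v\in\mathcal{P}$ for some vertex $v$. The maximal $\mathcal{P}$-subgraphs problem: given $G$, output $\mathcal{P}^m(G)$. The io-restricted maximal $\mathcal{P}$-subgraphs problem: given $G$ almost satisfying $\mathcal{P}$ and a vertex $v'$ of $G$, output $\mathcal{P}^m(G;v')$. A problem is solvable in total polynomial time if all outputs can be listed in time polynomial in $n$ (number of vertices of the input graph) and $K$ (number of graphs in the output). *)

(* Defs.v *)
From HB Require Import structures.
From mathcomp Require Import all_boot finmap.

Set Implicit Arguments.
Unset Strict Implicit.
Unset Printing Implicit Defensive.

Local Open Scope fset_scope.

(* Vertices are named by natural numbers; [None] plays the role of the missing
   root. Self-loops are allowed, as [E] is any subset of [V * V]. *)
Definition graph_wf (g : {fset nat} * {fset nat * nat} * option nat) : bool :=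
  let: (V, E, r) := g in
  (E `<=` V `*` V) && (if r is Some x then x \in V else true).

Record graph : Type := Graph {
  graph_val : {fset nat} * {fset nat * nat} * option nat;
  graph_valP : graph_wf graph_val }.

HB.instance Definition _ := [isSub for graph_val].
HB.instance Definition _ := [Choice of graph by <:].

Definition verts (G : graph) : {fset nat} := (graph_val G).1.1.
Definition edges (G : graph) : {fset nat * nat} := (graph_val G).1.2.
Definition groot (G : graph) : option nat := (graph_val G).2.

Definition reach (e : rel nat) (u v : nat) : Prop :=
  exists2 s : seq nat, path e u s & last u s = v.

Definition garc (G : graph) : rel nat := fun u v => (u, v) \in edges G.

(* The graph without vertices is connected. *)
Definition connected (G : graph) : Prop :=
  forall u v, u \in verts G -> v \in verts G ->
    reach (fun x y => garc G x y || garc G y x) u v.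

Definition rooted (G : graph) : Prop :=
  exists2 r, groot G = Some r & forall v, v \in verts G -> reach (garc G) r v.

Definition induced_val (G : graph) (S : {fset nat}) :=
  (verts G `&` S,
   [fset e in edges G | (e.1 \in S) && (e.2 \in S)],
   obind (fun x => if x \in S then Some x else None) (groot G)).

Lemma induced_wf (G : graph) (S : {fset nat}) : graph_wf (induced_val G S).
Proof.
have /andP[sEV rV] : graph_wf (verts G, edges G, groot G).
  by case: G => [[[V E] r] wfG].
apply/andP; split.
  apply/fsubsetP => e; rewrite !inE /= => /andP[eE /andP[e1 e2]].
  by have := fsubsetP sEV _ eE; rewrite !inE e1 e2 !andbT.
by case: (groot G) rV => //= x xV; case: ifP => //= xS; rewrite inE xV.
Qed.

Definition induced (G : graph) (S : {fset nat}) : graph :=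
  Graph (induced_wf G S).

Definition del_vertex (G : graph) (v : nat) : graph :=
  induced G (verts G `\ v).

Definition subIS (H G : graph) : Prop :=
  exists2 S, S `<=` verts G & H = induced G S.

Definition properIS (H G : graph) : Prop := subIS H G /\ H <> G.

(* A property is a set of (labelled) graphs; it is not required to be closed
   under isomorphism. *)

Definition connected_hereditary (P : pred graph) : Prop :=
  (forall G, P G -> connected G) /\
  (forall G H, P G -> subIS H G -> connected H -> P H).

Definition rooted_hereditary (P : pred graph) : Prop :=
  (forall G, P G -> rooted G) /\
  (forall G H, P G -> subIS H G -> rooted H -> P H).

Definition Psub (P : pred graph) (G H : graph) : Prop := subIS H G /\ P H.

Definition max_Psub (P : pred graph) (G H : graph) : Prop :=
  Psub P G H /\ (forall H', Psub P G H' -> ~ properIS H H').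

Definition almost_satisfies (P : pred graph) (G : graph) : Prop :=
  exists2 v, v \in verts G & P (del_vertex G v).

(* Programs are variable-free functional programs over S-expressions whose atoms
   are natural numbers. [eval p x y t] means that [p] maps [x] to [y] in [t]
   steps; it has no derivation when [p] diverges on [x]. Each step is a single
   operation of a random access machine with a heap of two-pointer cells:
   [Pair] copies a pointer and allocates one cell, and the arithmetic is that of
   the uniform-cost RAM. There is no multiplication, which at unit cost would
   break the polynomial equivalence with Turing machines. *)

Inductive sexp : Type := Atom of nat | Cell of sexp & sexp.

Inductive prog : Type :=
  | Id
  | Const of nat
  | Head
  | Tail
  | IsCell
  | Plus
  | Minus
  | Pair of prog & prog
  | Seq of prog & prog
  | If of prog & prog & prog
  | While of prog & prog.

Definition head_sexp (x : sexp) : sexp := if x is Cell y _ then y else Atom 0.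
Definition tail_sexp (x : sexp) : sexp := if x is Cell _ z then z else Atom 0.
Definition is_cell (x : sexp) : bool := if x is Cell _ _ then true else false.
Definition arith (op : nat -> nat -> nat) (x : sexp) : sexp :=
  if x is Cell (Atom a) (Atom b) then Atom (op a b) else Atom 0.
Definition truth (x : sexp) : bool := if x is Atom 0 then false else true.

Inductive eval : prog -> sexp -> sexp -> nat -> Prop :=
  | eval_Id x : eval Id x x 1
  | eval_Const n x : eval (Const n) x (Atom n) 1
  | eval_Head x : eval Head x (head_sexp x) 1
  | eval_Tail x : eval Tail x (tail_sexp x) 1
  | eval_IsCell x : eval IsCell x (Atom (is_cell x)) 1
  | eval_Plus x : eval Plus x (arith addn x) 1
  | eval_Minus x : eval Minus x (arith subn x) 1
  | eval_Pair p q x y z s t :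
      eval p x y s -> eval q x z t -> eval (Pair p q) x (Cell y z) (s + t).+1
  | eval_Seq p q x y z s t :
      eval p x y s -> eval q y z t -> eval (Seq p q) x z (s + t).+1
  | eval_If c p q x b y s t :
      eval c x b s -> eval (if truth b then p else q) x y t ->
      eval (If c p q) x y (s + t).+1
  | eval_While_stop c p x b s :
      eval c x b s -> ~~ truth b -> eval (While c p) x x s.+1
  | eval_While_step c p x b y z s t u :
      eval c x b s -> truth b -> eval p x y t -> eval (While c p) y z u ->
      eval (While c p) x z (s + t + u).+1.

Lemma eval_det p x y t y' t' :
  eval p x y t -> eval p x y' t' -> y = y' /\ t = t'.
Proof.
move=> e; move: y' t'.
induction e; intros y' t' e'; inversion e'; subst => //;
  repeat match goal with
  | IH : (forall y t, eval ?p ?x y t -> _), H : eval ?p ?x _ _ |- _ =>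
      case: (IH _ _ H) => ? ?; subst; clear H
  end => //;
  by match goal with
     | T : is_true (truth ?b), F : is_true (~~ truth ?b) |- _ =>
         rewrite T in F
     end.
Qed.

Definition enc_seq (T : Type) (enc : T -> sexp) (s : seq T) : sexp :=
  foldr (fun x v => Cell (enc x) v) (Atom 0) s.

Definition sorted_verts (G : graph) : seq nat := sort leq (verts G).

Definition sorted_edges (G : graph) : seq (nat * nat) :=
  [seq e <- [seq (u, v) | u <- sorted_verts G, v <- sorted_verts G]
     | e \in edges G].

Definition enc_graph (G : graph) : sexp :=
  Cell (enc_seq Atom (sorted_verts G))
    (Cell (enc_seq (fun e => Cell (Atom e.1) (Atom e.2)) (sorted_edges G))
      (if groot G is Some r then Cell (Atom r) (Atom 0) else Atom 0)).

Definition poly_time_decidable (P : pred graph) : Prop :=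
  exists (p : prog) (c d : nat), forall G : graph,
    exists2 t, eval p (enc_graph G) (Atom (P G)) t
             & t <= c * (#|` verts G| + 1) ^ d.

(* An instance [i] satisfying the promise [valid] asks for a list, in any order
   and without repetition, of the graphs [H] such that [sol i H]; [n i] is the
   number of vertices of the input graph, and [size Hs] the number of graphs
   in the output. *)
Definition total_poly_time (I : Type) (valid : I -> Prop) (n : I -> nat)
    (enc : I -> sexp) (sol : I -> graph -> Prop) : Prop :=
  exists (p : prog) (c d : nat), forall i : I, valid i ->
    exists (Hs : seq graph) (t : nat),
      [/\ uniq Hs,
          forall H, H \in Hs <-> sol i H,
          eval p (enc i) (enc_seq enc_graph Hs) t
        & t <= c * (n i + size Hs + 1) ^ d].

Definition maximal_Psubgraphs_tpt (P : pred graph) : Prop :=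
  total_poly_time (fun _ : graph => True) (fun G => #|` verts G|) enc_graph
    (max_Psub P).

Definition io_restricted_tpt (P : pred graph) : Prop :=
  total_poly_time
    (fun i : graph * nat => almost_satisfies P i.1 /\ i.2 \in verts i.1)
    (fun i => #|` verts i.1|)
    (fun i => Cell (enc_graph i.1) (Atom i.2))
    (fun i H => max_Psub P i.1 H /\ i.2 \in verts H).

(* Main.v *)
Require Import Defs.
From mathcomp Require Import all_boot finmap.
From mathcomp Require Import zify.

(* Call a vertex set S of G a P-set if G[S] is in P. In both cases of the
   hypothesis, (A) if T < S are P-sets, then T + v is a P-set for some v in
   S - T; (B) if two P-sets contained in a third one share a vertex, their union
   is a P-set; (C) there is a least P-set, empty or reduced to the root, as soon
   as there is a P-set.

   By (A), a P-set extends greedily to a maximal one. Starting from an extension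
   of the least P-set, the algorithm takes each maximal P-set H found so far and
   each vertex v outside H, solves the io-restricted problem on (G[H + v], v),
   and extends every answer to a maximal P-set of G. The number of answers is at
   most the number K of maximal P-sets of G: by (B), two answers with the same
   extension are equal. Every maximal P-set S is found: a P-set T < S contained
   in some found H can be enlarged, by the vertex v of (A), to T + v, which is
   contained in H if v is in H, and otherwise in an answer for (H, v). *)

Set Implicit Arguments.
Unset Strict Implicit.
Unset Printing Implicit Defensive.

(** * Programs and their running time *)

(** Times are only bounded from above, so that each cost can be rounded up to a convenient
    expression. *)
Definition run (p : prog) (x y : sexp) (B : nat) : Prop :=
  exists2 t, eval p x y t & t <= B.

Lemma run_le p x y A B : run p x y A -> A <= B -> run p x y B.
Proof. by move=> [t ev tA] AB; exists t => //; apply: leq_trans AB. Qed.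

Lemma run_id x : run Id x x 1.
Proof. by exists 1 => //; constructor. Qed.

Lemma run_const n x : run (Const n) x (Atom n) 1.
Proof. by exists 1 => //; constructor. Qed.

Lemma run_head x : run Head x (head_sexp x) 1.
Proof. by exists 1 => //; constructor. Qed.

Lemma run_tail x : run Tail x (tail_sexp x) 1.
Proof. by exists 1 => //; constructor. Qed.

Lemma run_minus x : run Minus x (arith subn x) 1.
Proof. by exists 1 => //; constructor. Qed.

Lemma run_pair p q x y z s t :
  run p x y s -> run q x z t -> run (Pair p q) x (Cell y z) (s + t).+1.
Proof.
move=> [i ep lei] [j eq lej]; exists (i + j).+1; first exact: eval_Pair.
by rewrite ltnS leq_add.
Qed.

Lemma run_seq p q x y z s t :
  run p x y s -> run q y z t -> run (Seq p q) x z (s + t).+1.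
Proof.
move=> [i ep lei] [j eq lej]; exists (i + j).+1; first exact: eval_Seq ep eq.
by rewrite ltnS leq_add.
Qed.

Lemma run_if c p q x b y s t :
  run c x b s -> run (if truth b then p else q) x y t ->
  run (If c p q) x y (s + t).+1.
Proof.
move=> [i ep lei] [j eq lej]; exists (i + j).+1; first exact: eval_If ep eq.
by rewrite ltnS leq_add.
Qed.

(** The measure [mu] bounds the number of rounds, and the extra unit in [(mu a).+1] pays for the
    final failing test. The invariant speaks of abstract states [a], of which the program sees only
    [enc a]. *)
Lemma run_while (A : Type) (enc val : A -> sexp) (I : A -> Prop)
    (mu : A -> nat) c p s B :
  (forall a, I a -> run c (enc a) (val a) s) ->
  (forall a, I a -> truth (val a) ->
     exists a', [/\ run p (enc a) (enc a') B, I a' & mu a' < mu a]) ->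
  forall a, I a -> exists a',
    [/\ run (While c p) (enc a) (enc a') ((mu a).+1 * (s + B + 1)),
        I a' & ~~ truth (val a')].
Proof.
move=> hc hp a; have [k] := ubnP (mu a); elim: k a => // k IHk a /ltnSE lek Ia.
have [i ei lei] := hc a Ia; case: (boolP (truth (val a))) => ta; last first.
  exists a; split=> //; exists i.+1; first exact: eval_While_stop ei ta.
  by rewrite mulSn; lia.
have [a1 [[j ej lej] Ia1 ltmu]] := hp a Ia ta.
have [a' [[u eu leu] Ia' fa']] := IHk a1 (leq_trans ltmu lek) Ia1.
exists a'; split=> //; exists (i + j + u).+1.
  exact: eval_While_step ei ta ej eu.
have := leq_mul ltmu (leqnn (s + B + 1)); rewrite !mulSn; lia.
Qed.

(** Inputs are right-nested pairs used as environments: [Var k] reads the component of index [k],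
    and [Skip k] drops the first [k] components. *)
Definition Skip (k : nat) : prog := iter k (Seq Tail) Id.
Definition Var (k : nat) : prog := Seq (Skip k) Head.
Definition skip_sexp (k : nat) (x : sexp) : sexp := iter k tail_sexp x.

Lemma run_skip k x : run (Skip k) x (skip_sexp k x) (k.*2.+1).
Proof.
elim: k x => [|k IHk] x; first exact: run_id.
have := run_seq (run_tail x) (IHk (tail_sexp x)).
by rewrite /skip_sexp -iterSr => /run_le; apply; rewrite doubleS; lia.
Qed.

Lemma run_var k x : run (Var k) x (head_sexp (skip_sexp k x)) (k.*2 + 3).
Proof.
have := run_seq (run_skip k x) (run_head _).
by move=> /run_le; apply; lia.
Qed.

Ltac run_prim :=
  repeat first
    [ apply: run_id | apply: run_const | apply: run_head | apply: run_tail
    | apply: run_minus | apply: run_skip | apply: run_var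
    | apply: run_pair | apply: run_seq ].

(* [Fold pl pi body] runs [body] on [Cell x (Cell acc e)] for each item [x] of
   the list computed by [pl], where [e] is the input. *)
Definition Fold (pl pi body : prog) : prog :=
  Seq (Pair pl (Pair pi Id))
    (Seq (While Head
       (Pair (Seq Head Tail)
         (Pair (Seq (Pair (Seq Head Head) Tail) body) (Skip 2))))
     (Var 1)).

Lemma run_fold (T : Type) (enc : T -> sexp) (I : seq T -> sexp -> Prop)
    pl pi body e l a0 s t B N :
  run pl e (enc_seq enc l) s -> run pi e a0 t -> size l <= N -> I [::] a0 ->
  (forall l1 x l2 a, l = l1 ++ x :: l2 -> I l1 a ->
     exists2 a', run body (Cell (enc x) (Cell a e)) a' B & I (rcons l1 x) a') ->
  exists2 a, run (Fold pl pi body) e a (s + t + N.+1 * (B + 40)) & I l a.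
Proof.
move=> rl ri leN I0 hb.
(* The processed prefix [a.1.1] is a ghost component: the invariant mentions it, but it is not
   encoded. *)
pose encs (a : seq T * seq T * sexp) :=
  Cell (enc_seq enc a.1.2) (Cell a.2 e).
pose J (a : seq T * seq T * sexp) := l = a.1.1 ++ a.1.2 /\ I a.1.1 a.2.
pose mu (a : seq T * seq T * sexp) := size a.1.2.
rewrite /Fold; set step := Pair (Seq Head Tail) _.
have hc a : J a -> run Head (encs a) (enc_seq enc a.1.2) 1.
  by move=> _; apply: run_head.
have hp a : J a -> truth (enc_seq enc a.1.2) -> exists a',
    [/\ run step (encs a) (encs a') (B + 20), J a' & mu a' < mu a].
  case: a => [[l1 [|x l2]] a] [/= El Ia] // _.
  have [a' ra Ia'] := hb _ _ _ _ El Ia.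
  exists (rcons l1 x, l2, a'); split=> //; last by split; rewrite ?cat_rcons.
  eapply run_le.
    apply: run_pair; first by run_prim.
    apply: run_pair; last by run_prim.
    by apply: run_seq ra; run_prim.
  by rewrite /=; lia.
have [[[l1 l2] a] /= [rw [/= El Ia] tn]] :=
  run_while hc hp (conj erefl I0 : J ([::], l, a0)).
case: l2 => // in rw El tn *.
exists a; last by rewrite El cats0.
eapply run_le.
  apply: run_seq; last apply: run_seq rw _; last by run_prim.
  by apply: run_pair rl _; apply: run_pair ri _; run_prim.
have := leq_mul leN (leqnn (B + 22)).
by rewrite /mu /=; lia.
Qed.

(** The body need only be correct on the partial results that occur, so invariants of the fold, such
    as [good], may be used when its body is analysed. *)
Lemma run_foldl (T A : Type) (enc : T -> sexp) (encA : A -> sexp)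
    (f : A -> T -> A) pl pi body e l a0 s t B N :
  run pl e (enc_seq enc l) s -> run pi e (encA a0) t -> size l <= N ->
  (forall l1 x l2, l = l1 ++ x :: l2 ->
     run body (Cell (enc x) (Cell (encA (foldl f a0 l1)) e))
       (encA (f (foldl f a0 l1) x)) B) ->
  run (Fold pl pi body) e (encA (foldl f a0 l)) (s + t + N.+1 * (B + 40)).
Proof.
move=> rl ri leN hb.
pose I l1 a := a = encA (foldl f a0 l1).
have hI l1 x l2 a : l = l1 ++ x :: l2 -> I l1 a ->
    exists2 a', run body (Cell (enc x) (Cell a e)) a' B & I (rcons l1 x) a'.
  move=> El ->; exists (encA (f (foldl f a0 l1) x)); first exact: hb El.
  by rewrite /I foldl_rcons.
by have [a ra Ea] := run_fold rl ri leN (erefl : I [::] _) hI; rewrite -Ea.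
Qed.

(** * Equality, membership and filtering of lists *)

Lemma run_ifb c p q x (b : bool) y s t :
  run c x (Atom b) s -> (b -> run p x y t) -> (~~ b -> run q x y t) ->
  run (If c p q) x y (s + t).+1.
Proof.
move=> rc rp rq; apply: run_if rc _.
by case: b rp rq => rp rq /=; [apply: rp | apply: rq].
Qed.

(** Two numbers are equal iff both truncated differences vanish. *)
Definition Eq : prog :=
  If Minus (Const 0) (If (Seq (Pair Tail Head) Minus) (Const 0) (Const 1)).

Lemma run_eq a b : run Eq (Cell (Atom a) (Atom b)) (Atom (a == b)) 20.
Proof.
eapply run_le.
  apply: run_if; first by run_prim.
  rewrite /=; case: (ltngtP a b) => [ltab|ltba|->].
  - have -> : a - b = 0 by lia.
    apply: run_if => /=; first by run_prim.
    rewrite /=; case Eba: (b - a) => [|k]; first by lia.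
    exact: run_const.
  - case Eba: (a - b) => [|k]; first by lia.
    exact: run_le (run_const _ _) _.
  - rewrite subnn /=; apply: run_if; first by run_prim.
    by rewrite /= subnn; apply: run_const.
by [].
Qed.

Definition Member : prog :=
  Fold Tail (Const 0)
    (If (Seq (Pair (Var 0) (Var 2)) Eq) (Const 1) (Var 1)).

(** This and the later cost functions are built from sums, products and fixed powers only, which is
    how [poly_bounded_mainc] finds their total polynomial. *)
Definition memc (m : nat) : nat := m.+1 * 100.

Lemma run_mem v l m : size l <= m ->
  run Member (Cell (Atom v) (enc_seq Atom l)) (Atom (v \in l)) (memc m).
Proof.
move=> lem.
have -> : (v \in l) = foldl (fun b x => (x == v) || b) false l.
  rewrite -[LHS]orbF; elim: l {lem} false => //= x l IHl b.
  by rewrite inE eq_sym -IHl orbAC orbC orbA.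
have r := @run_foldl _ _ Atom (fun b : bool => Atom b)
  (fun b x => (x == v) || b) Tail (Const 0)
  (If (Seq (Pair (Var 0) (Var 2)) Eq) (Const 1) (Var 1))
  (Cell (Atom v) (enc_seq Atom l)) l false 1 1 50 m.
apply: run_le (r _ _ _ _) _ => //; [exact: run_tail|exact: run_const| |].
  move=> l1 x l2 _; eapply run_le.
    apply: (run_ifb (b := x == v) (t := 10)).
    - by apply: run_seq (run_eq x v); run_prim.
    - by move=> -> /=; apply: run_le (run_const _ _) _.
    - by move=> /negbTE->; apply: run_le (run_var _ _) _.
  by [].
by rewrite /memc; lia.
Qed.

Definition Rev : prog := Fold Id (Const 0) (Pair (Var 0) (Var 1)).

Lemma run_rev (T : Type) (enc : T -> sexp) l N : size l <= N ->
  run Rev (enc_seq enc l) (enc_seq enc (rev l)) (N.+1 * 70).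
Proof.
move=> leN.
have -> : rev l = foldl (fun s x => x :: s) [::] l.
  by rewrite /rev; elim: l [::] {leN} => //= x l IHl s.
have r := @run_foldl _ _ enc (enc_seq enc) (fun s x => x :: s) Id (Const 0)
  (Pair (Var 0) (Var 1)) (enc_seq enc l) l [::] 1 1 20 N.
apply: run_le (r _ _ _ _) _ => //; [exact: run_id|exact: run_const| |].
  by move=> l1 x l2 _; eapply run_le; [run_prim|].
by lia.
Qed.

(** The fold conses the kept items in reverse order. [Rev] restores the order, which matters because
    [enc_graph] lists vertices and edges in a fixed order. *)
Definition Filter (q : prog) : prog :=
  Seq (Fold Head (Const 0)
         (If (Seq (Pair (Var 0) (Skip 3)) q) (Pair (Var 0) (Var 1)) (Var 1)))
    Rev.

Definition filterc (N B : nat) : nat := N.+1 * (B + 200).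

Lemma run_filter (T : eqType) (enc : T -> sexp) (a : pred T) q e l N B :
  size l <= N ->
  {in l, forall x, run q (Cell (enc x) e) (Atom (a x)) B} ->
  run (Filter q) (Cell (enc_seq enc l) e) (enc_seq enc (filter a l))
    (filterc N B).
Proof.
move=> leN hq; pose f s x := if a x then x :: s else s.
have Ef : foldl f [::] l = rev (filter a l).
  suff H s : foldl f s l = rev (filter a l) ++ s by rewrite H cats0.
  elim: l s {leN hq} => //= x l IHl s; rewrite IHl /f.
  by case: ifP => // _; rewrite rev_cons cat_rcons.
have r := @run_foldl _ _ enc (enc_seq enc) f Head (Const 0)
  (If (Seq (Pair (Var 0) (Skip 3)) q) (Pair (Var 0) (Var 1)) (Var 1))
  (Cell (enc_seq enc l) e) l [::] 1 1 (B + 50) N.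
eapply run_le.
  apply: run_seq.
    apply: r => //; [exact: run_head|exact: run_const|].
    move=> l1 x l2 El; rewrite /f.
    have rq : run q (Cell (enc x) e) (Atom (a x)) B.
      by apply: hq; rewrite El mem_cat mem_head orbT.
    eapply run_le.
      apply: (run_ifb (t := 20)).
      - by apply: run_seq rq; run_prim.
      - by move=> ->; eapply run_le; [run_prim|].
      - by move=> /negbTE->; eapply run_le; [run_prim|].
    by rewrite /=; lia.
  rewrite Ef -[in enc_seq _ (filter _ _)](revK (filter a l)); apply: run_rev.
  by rewrite size_rev size_filter; apply: leq_trans (count_size _ _) leN.
by rewrite /filterc; lia.
Qed.

Definition Member2 : prog :=
  If (Seq (Pair (Seq Head Head) Tail) Member)
    (Seq (Pair (Seq Head Tail) Tail) Member) (Const 0).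

Definition enc_edge (e : nat * nat) : sexp := Cell (Atom e.1) (Atom e.2).

Lemma run_mem2 e l m : size l <= m ->
  run Member2 (Cell (enc_edge e) (enc_seq Atom l))
    (Atom ((e.1 \in l) && (e.2 \in l))) (memc m + memc m + 30).
Proof.
move=> lem; eapply run_le.
  apply: (run_ifb (b := e.1 \in l) (t := memc m + 10)).
  - by apply: run_seq (run_mem _ lem); run_prim.
  - move=> ->; eapply run_le.
      by apply: run_seq (run_mem _ lem); run_prim.
    by rewrite /=; lia.
  - by move=> /negbTE->; apply: run_le (run_const _ _) _; lia.
by rewrite /=; lia.
Qed.

(* The encoding of the root is also that of a list with at most one item, so
   that it can be filtered like the vertices. *)
Definition Induce : prog :=
  Pair (Seq (Pair (Var 1) Head) (Filter Member))
    (Pair (Seq (Pair (Var 2) Head) (Filter Member2))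
       (Seq (Pair (Skip 3) Head) (Filter Member))).

Definition inducec (m : nat) : nat :=
  filterc m (memc m) + filterc (m * m) (memc m + memc m + 30)
  + filterc 1 (memc m) + 60.

(** * Encodings of induced subgraphs *)

Local Open Scope fset_scope.

Lemma mem_verts_induced G S x :
  (x \in verts (induced G S)) = (x \in verts G) && (x \in S).
Proof. by rewrite /verts /= !inE. Qed.

Lemma mem_edges_induced G S e :
  (e \in edges (induced G S)) = [&& e \in edges G, e.1 \in S & e.2 \in S].
Proof. by rewrite [edges _]/(edges _) /= !inE. Qed.

Lemma mem_sorted_verts G x : (x \in sorted_verts G) = (x \in verts G).
Proof. by rewrite mem_sort. Qed.

Lemma sorted_verts_uniq G : uniq (sorted_verts G).
Proof. by rewrite sort_uniq fset_uniq. Qed.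

Lemma size_sorted_verts G : size (sorted_verts G) = #|` verts G|.
Proof. by rewrite size_sort. Qed.

Lemma size_sorted_edges G :
  size (sorted_edges G) <= #|` verts G| * #|` verts G|.
Proof.
rewrite size_filter; apply: leq_trans (count_size _ _) _.
by rewrite size_allpairs !size_sorted_verts.
Qed.

Lemma sorted_verts_induced G S :
  sorted_verts (induced G S) = [seq x <- sorted_verts G | x \in S].
Proof.
apply: (sorted_eq leq_trans anti_leq).
- exact: sort_sorted leq_total _.
- exact: sorted_filter leq_trans _ _ (sort_sorted leq_total _).
apply: uniq_perm; rewrite ?filter_uniq ?sorted_verts_uniq // => x.
by rewrite mem_sorted_verts mem_verts_induced mem_filter mem_sorted_verts andbC.
Qed.

Lemma allpairs_filter (T U : Type) (a : pred T) (b : pred U) s t :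
  [seq (x, y) | x <- filter a s, y <- filter b t] =
  [seq e <- [seq (x, y) | x <- s, y <- t] | a e.1 && b e.2].
Proof.
elim: s => //= x s IHs; rewrite filter_cat -IHs.
have -> : [seq e <- [seq (x, y) | y <- t] | a e.1 && b e.2] =
    if a x then [seq (x, y) | y <- filter b t] else [::].
  by elim: t {IHs} => [|y t /= ->]; case: (a x) => //=; case: (b y).
by case: (a x).
Qed.

Lemma sorted_edges_induced G S :
  sorted_edges (induced G S) =
  [seq e <- sorted_edges G | (e.1 \in S) && (e.2 \in S)].
Proof.
rewrite /sorted_edges sorted_verts_induced allpairs_filter -!filter_predI.
by apply: eq_filter => e /=; rewrite mem_edges_induced; do !case: (_ \in _).
Qed.

(** Filtering preserves sortedness, so each of the three lists in the encoding of [G] just has to be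
    filtered; this is what [Induce] does. *)
Lemma enc_graph_induced G (l : seq nat) :
  enc_graph (induced G [fset x in l]) =
  Cell (enc_seq Atom [seq x <- sorted_verts G | x \in l])
    (Cell (enc_seq enc_edge
            [seq e <- sorted_edges G | (e.1 \in l) && (e.2 \in l)])
       (enc_seq Atom [seq x <- seq_of_opt (groot G) | x \in l])).
Proof.
rewrite /enc_graph sorted_verts_induced sorted_edges_induced.
congr (Cell _ (Cell _ _)).
- by congr (enc_seq _ _); apply: eq_filter => x; rewrite inE.
- by congr (enc_seq _ _); apply: eq_filter => e; rewrite !inE.
by rewrite {1}/groot /=; case: (groot G) => //= x; rewrite inE; case: ifP.
Qed.

Lemma run_induce G l m : size l <= m -> #|` verts G| <= m ->
  run Induce (Cell (enc_seq Atom l) (enc_graph G))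
    (enc_graph (induced G [fset x in l])) (inducec m).
Proof.
move=> lel leG; rewrite enc_graph_induced.
set e := enc_seq Atom l.
have rV : run (Filter Member) (Cell (enc_seq Atom (sorted_verts G)) e)
    (enc_seq Atom [seq x <- sorted_verts G | x \in l]) (filterc m (memc m)).
  apply: run_filter; first by rewrite size_sorted_verts.
  by move=> x _; apply: run_mem.
have rE : run (Filter Member2) (Cell (enc_seq enc_edge (sorted_edges G)) e)
    (enc_seq enc_edge [seq e <- sorted_edges G | (e.1 \in l) && (e.2 \in l)])
    (filterc (m * m) (memc m + memc m + 30)).
  apply: run_filter.
    by apply: leq_trans (size_sorted_edges G) _; rewrite leq_mul.
  by move=> x _; apply: run_mem2.
have rr : run (Filter Member) (Cell (enc_seq Atom (seq_of_opt (groot G))) e)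
    (enc_seq Atom [seq x <- seq_of_opt (groot G) | x \in l])
    (filterc 1 (memc m)).
  apply: run_filter; first by case: (groot G).
  by move=> x _; apply: run_mem.
have Er : (if groot G is Some r then Cell (Atom r) (Atom 0) else Atom 0) =
    enc_seq Atom (seq_of_opt (groot G)) by case: (groot G).
rewrite /enc_graph Er; eapply run_le.
  apply: run_pair; first by apply: run_seq rV; run_prim.
  apply: run_pair; first by apply: run_seq rE; run_prim.
  by apply: run_seq rr; run_prim.
by rewrite /inducec /=; lia.
Qed.

(** * Maximal P-sets of a graph *)

Lemma graph_eqP (G H : graph) :
  verts G = verts H -> edges G = edges H -> groot G = groot H -> G = H.
Proof.
move=> EV EE Er; apply: val_inj; move: EV EE Er.
rewrite /verts /edges /groot /=.
by case: (graph_val G) (graph_val H) => [[? ?] ?] [[? ?] ?] /= -> -> ->.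
Qed.

Lemma verts_induced G S : verts (induced G S) = verts G `&` S.
Proof. by []. Qed.

Lemma groot_induced G S : groot (induced G S) =
  obind (fun x => if x \in S then Some x else None) (groot G).
Proof. by []. Qed.

Lemma verts_induced_sub G S : S `<=` verts G -> verts (induced G S) = S.
Proof. by rewrite verts_induced => /fsetIidPr. Qed.

Lemma induced_induced G S T : T `<=` S -> induced (induced G S) T = induced G T.
Proof.
move=> sTS; apply: graph_eqP.
- by rewrite !verts_induced -fsetIA (fsetIidPr sTS).
- apply/fsetP => e; rewrite !mem_edges_induced; case: (e \in edges G) => //=.
  case: (boolP (e.1 \in T)) => [/(fsubsetP sTS)->|]; rewrite ?andbF //=.
  by case: (boolP (e.2 \in T)) => [/(fsubsetP sTS)->|]; rewrite ?andbF.
rewrite !groot_induced; case: (groot G) => //= r.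
case: (boolP (r \in T)) => [/[dup] rT /(fsubsetP sTS)->|rT] /=.
  by rewrite rT.
by case: ifP => //= _; rewrite (negbTE rT).
Qed.

Lemma induced_inj G S T : S `<=` verts G -> T `<=` verts G ->
  induced G S = induced G T -> S = T.
Proof.
by move=> sS sT /(congr1 verts); rewrite !verts_induced_sub.
Qed.

Lemma subIS_induced G S T : T `<=` S -> S `<=` verts G ->
  subIS (induced G T) (induced G S).
Proof.
by move=> sTS sSV; exists T; rewrite ?verts_induced_sub // induced_induced.
Qed.

(** * Reachability *)

Lemma garc_induced G S x y :
  garc (induced G S) x y = [&& garc G x y, x \in S & y \in S].
Proof. exact: mem_edges_induced. Qed.

Lemma reach_mono (e e' : rel nat) u v :
  subrel e e' -> reach e u v -> reach e' u v.
Proof. by move=> sub [s ps ls]; exists s => //; apply: sub_path ps. Qed.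

Lemma reach_trans e u v w : reach e u v -> reach e v w -> reach e u w.
Proof.
move=> [s ps ls] [t pt lt]; exists (s ++ t); last by rewrite last_cat ls.
by rewrite cat_path ps ls.
Qed.

Lemma reach1 (e : rel nat) u v : e u v -> reach e u v.
Proof. by move=> euv; exists [:: v]; rewrite /= ?euv. Qed.

(** The arc sought enters the first vertex of the path outside [T]. This is the source of the new
    vertex in (A). *)
Lemma reach_exit (e : rel nat) (T : {fset nat}) u v :
  reach e u v -> u \in T -> v \notin T ->
  exists x y, [/\ e x y, x \in T & y \notin T].
Proof.
move=> [s ps <-]; elim: s u ps => [|y s IHs] u /= => [_ ->//|/andP[euy ps] uT].
case: (boolP (y \in T)) => yT lT; last by exists u, y.
exact: IHs ps yT lT.
Qed.

(** * The set system of P-sets *)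

Section Hereditary.

Variable P : pred graph.

Definition Pset (G : graph) (S : {fset nat}) : bool := P (induced G S).

Definition Pmaxset (G : graph) (S : {fset nat}) : Prop :=
  [/\ S `<=` verts G, Pset G S
    & forall T, S `<=` T -> T `<=` verts G -> Pset G T -> T = S].

(** This is (A): apart from the empty set, which may fail to be a P-set, it says that the P-sets
    form a strongly accessible set system. *)
Definition accessible : Prop := forall G S T,
  S `<=` verts G -> T `<=` S -> T != S -> Pset G S -> Pset G T ->
  exists2 v, v \in S `\` T & Pset G (v |` T).

(** This is (B), a local form of confluence. The common superset [S] is essential: two cliques
    sharing a vertex need not have a clique as union. *)
Definition glueable : Prop := forall G S T1 T2 v,
  S `<=` verts G -> T1 `<=` S -> T2 `<=` S ->
  Pset G S -> Pset G T1 -> Pset G T2 -> v \in T1 -> v \in T2 ->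
  Pset G (T1 `|` T2).

Lemma fproper_witness (S T : {fset nat}) :
  T `<=` S -> T != S -> exists2 s, s \in S & s \notin T.
Proof.
move=> sTS neq; have /fset0Pn[s] : S `\` T != fset0.
  by apply: contra neq; rewrite fsetD_eq0 eqEfsubset sTS.
by rewrite !inE => /andP[sT sS]; exists s.
Qed.

(** * The connected case *)

Lemma connected_induced_mono G S T u v : S `<=` T ->
  reach (fun x y => garc (induced G S) x y || garc (induced G S) y x) u v ->
  reach (fun x y => garc (induced G T) x y || garc (induced G T) y x) u v.
Proof.
move=> /fsubsetP sST; apply: reach_mono => x y; rewrite !garc_induced.
by case/orP=> /and3P[-> /sST-> /sST->]; rewrite ?orbT.
Qed.

Lemma connected_her_Pset G S T : connected_hereditary P ->
  T `<=` S -> S `<=` verts G -> Pset G S -> connected (induced G T) ->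
  Pset G T.
Proof.
by move=> [_ her] sTS sSV PS cT; apply: her PS (subIS_induced sTS sSV) cT.
Qed.

(** As G[S] is connected, an edge joins some x in T to some y in S outside T. Then G[T + y] is
    connected, and heredity below S applies. *)
Lemma connected_her_accessible : connected_hereditary P -> accessible.
Proof.
move=> hP G S T sSV sTS neTS PS PT.
have her v : v \in S -> connected (induced G (v |` T)) -> Pset G (v |` T).
  move=> vS; apply: connected_her_Pset PS => //.
  by rewrite fsubUset fsub1set vS.
have [s sS sT] := fproper_witness sTS neTS.
(* No edge leaves an empty T, but then any vertex of S will do, a single vertex being connected. *)
have [T0|[t tT]] := fset_0Vmem T.
  exists s; first by rewrite inE sS sT.
  apply: her => // u v; rewrite !mem_verts_induced T0 fsetU0 !inE.
  by move=> /andP[_ /eqP->] /andP[_ /eqP->]; exists [::].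
have mV x : x \in S -> x \in verts (induced G S).
  by move=> xS; rewrite verts_induced_sub.
have cS := hP.1 _ PS _ _ (mV t (fsubsetP sTS _ tT)) (mV s sS).
have [x [y [exy xT yT]]] := reach_exit cS tT sT.
have yS : y \in S.
  by case/orP: exy; rewrite garc_induced => /and3P[].
exists y; first by rewrite inE yS yT.
have sTV : T `<=` verts G by apply: fsubset_trans sSV.
pose e a b := garc (induced G (y |` T)) a b || garc (induced G (y |` T)) b a.
have cT u v : u \in T -> v \in T -> reach e u v.
  move=> uT vT; apply: (@connected_induced_mono G T); first exact: fsubsetU1.
  by apply: hP.1 PT _ _ _ _; rewrite verts_induced_sub.
have [exy' eyx] : e x y /\ e y x.
  move: exy; rewrite /e !garc_induced !inE eqxx xT ?orbT /= !andbT.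
  by case/orP=> /and3P[-> _ _]; rewrite !orbT.
apply: her => // u v; rewrite !mem_verts_induced !inE.
move=> /andP[_ /predU1P[->|uT]] /andP[_ /predU1P[->|vT]].
- by exists [::].
- by apply: reach_trans (reach1 eyx) (cT _ _ xT vT).
- by apply: reach_trans (cT _ _ uT xT) (reach1 exy').
- exact: cT.
Qed.

(** Walks between the two parts are routed through the shared vertex [w], so the union is connected;
    heredity below S concludes. *)
Lemma connected_her_glueable : connected_hereditary P -> glueable.
Proof.
move=> hP G S T1 T2 w sSV s1 s2 PS P1 P2 w1 w2.
apply: (connected_her_Pset hP _ sSV PS); first by rewrite fsubUset s1.
pose e a b :=
  garc (induced G (T1 `|` T2)) a b || garc (induced G (T1 `|` T2)) b a.
have c T u v : T `<=` T1 `|` T2 -> T `<=` S -> Pset G T -> u \in T -> v \in T ->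
    reach e u v.
  move=> sT sTS PT uT vT; apply: connected_induced_mono sT _.
  by apply: hP.1 PT _ _ _ _; rewrite verts_induced_sub // (fsubset_trans sTS).
have c1 u v := c T1 u v (fsubsetUl _ _) s1 P1.
have c2 u v := c T2 u v (fsubsetUr _ _) s2 P2.
move=> u v; rewrite !mem_verts_induced !inE.
move=> /andP[_ /orP[u1|u2]] /andP[_ /orP[v1|v2]].
- exact: c1.
- exact: reach_trans (c1 _ _ u1 w1) (c2 _ _ w2 v2).
- exact: reach_trans (c2 _ _ u2 w2) (c1 _ _ w1 v1).
- exact: c2.
Qed.

(** * The rooted case *)

Lemma rooted_inducedP G S : S `<=` verts G ->
  rooted (induced G S) <->
  exists2 r, groot G = Some r /\ r \in S
           & forall v, v \in S -> reach (garc (induced G S)) r v.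
Proof.
move=> sSV; split=> [[r]|[r [Gr rS] hr]].
  rewrite groot_induced verts_induced_sub //; case: (groot G) => //= x.
  by case: ifP => // xS [<-] hr; exists x.
by exists r; rewrite ?groot_induced ?Gr /= ?rS // verts_induced_sub.
Qed.

Lemma reach_induced_mono G S T u v : S `<=` T ->
  reach (garc (induced G S)) u v -> reach (garc (induced G T)) u v.
Proof.
move=> /fsubsetP sST; apply: reach_mono => x y; rewrite !garc_induced.
by case/and3P=> -> /sST-> /sST->.
Qed.

Lemma rooted_her_Pset G S T : rooted_hereditary P ->
  T `<=` S -> S `<=` verts G -> Pset G S -> rooted (induced G T) -> Pset G T.
Proof.
by move=> [_ her] sTS sSV PS rT; apply: her PS (subIS_induced sTS sSV) rT.
Qed.

(** Both sets contain the root of G. A directed path in G[S] from it to a vertex outside T leaves T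
    by an arc, whose head can be added. *)
Lemma rooted_her_accessible : rooted_hereditary P -> accessible.
Proof.
move=> hP G S T sSV sTS neTS PS PT.
have [s sS sT] := fproper_witness sTS neTS.
have sTV : T `<=` verts G by apply: fsubset_trans sSV.
have [r [Gr rT] hr] := (rooted_inducedP sTV).1 (hP.1 _ PT).
have [r' [Gr' rS] hr'] := (rooted_inducedP sSV).1 (hP.1 _ PS).
move: Gr' rS hr'; rewrite Gr => -[<-] rS hr'.
have [x [y [exy xT yT]]] := reach_exit (hr' s sS) rT sT.
move: exy; rewrite garc_induced => /and3P[exy xS yS].
exists y; first by rewrite inE yS yT.
have sU : y |` T `<=` S by rewrite fsubUset fsub1set yS.
apply: (rooted_her_Pset hP sU sSV PS).
apply/rooted_inducedP; first exact: fsubset_trans sU sSV.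
have hT v : v \in T -> reach (garc (induced G (y |` T))) r v.
  by move=> vT; apply: reach_induced_mono (hr v vT); apply: fsubsetU1.
exists r; first by rewrite !inE rT orbT.
move=> v; rewrite !inE => /predU1P[->|]; last exact: hT.
apply: reach_trans (hT x xT) (reach1 _).
by rewrite garc_induced exy !inE xT eqxx orbT.
Qed.

(** Both sets contain the root of G, which reaches every vertex of the union inside the part where
    that vertex lies. *)
Lemma rooted_her_glueable : rooted_hereditary P -> glueable.
Proof.
move=> hP G S T1 T2 w sSV s1 s2 PS P1 P2 w1 w2.
have sU : T1 `|` T2 `<=` S by rewrite fsubUset s1.
apply: (rooted_her_Pset hP sU sSV PS).
have [r [Gr r1] h1] :=
  (rooted_inducedP (fsubset_trans s1 sSV)).1 (hP.1 _ P1).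
have [r' [Gr' r2] h2] :=
  (rooted_inducedP (fsubset_trans s2 sSV)).1 (hP.1 _ P2).
move: Gr' r2 h2; rewrite Gr => -[<-] r2 h2.
apply/rooted_inducedP; first exact: fsubset_trans sU sSV.
exists r; first by rewrite !inE r1.
move=> v; rewrite inE => /orP[/h1|/h2]; apply: reach_induced_mono.
  exact: fsubsetUl.
exact: fsubsetUr.
Qed.

(** This is (C) in the connected case. *)
Lemma connected_her_fset0 G S : connected_hereditary P ->
  S `<=` verts G -> Pset G S -> Pset G fset0.
Proof.
move=> hP sSV PS; apply: connected_her_Pset hP _ sSV PS _ => // u v.
by rewrite mem_verts_induced inE andbF.
Qed.

(** This is (C) in the rooted case. The root is taken as a list of at most one vertex, the form in
    which it is encoded. *)
Lemma rooted_her_root G S : rooted_hereditary P ->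
  S `<=` verts G -> Pset G S ->
  Pset G [fset x in seq_of_opt (groot G)] /\
  [fset x in seq_of_opt (groot G)] `<=` S.
Proof.
move=> hP sSV PS.
have [r [Gr rS] _] := (rooted_inducedP sSV).1 (hP.1 _ PS); rewrite Gr.
have sr : [fset x in seq_of_opt (Some r)] `<=` S.
  by apply/fsubsetP => x; rewrite !inE orbF => /eqP->.
split=> //; apply: (rooted_her_Pset hP sr sSV PS).
apply/rooted_inducedP; first exact: fsubset_trans sr sSV.
exists r; rewrite ?inE ?eqxx // => v.
by rewrite !inE orbF => /eqP->; exists [::].
Qed.

(** Induced subgraphs correspond to vertex sets, as [induced G] is injective on subsets of
    [verts G]; from here on only sets are considered. *)
Lemma max_Psub_maxset G H :
  max_Psub P G H <-> exists2 S, Pmaxset G S & H = induced G S.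
Proof.
split=> [[[[S sSV ->] PS] mx]|[S [sSV PS mx] ->]].
  exists S => //; split=> // T sST sTV PT; apply/eqP; apply/negPn/negP => neTS.
  apply: (mx (induced G T)); first by split=> //; exists T.
  split; first exact: subIS_induced.
  by move/(induced_inj sSV sTV)=> E; rewrite E eqxx in neTS.
split; first by split=> //; exists S.
move=> H' [[T sTV ->] PT] [[U sUT ES] neST]; apply: neST.
rewrite verts_induced_sub // in sUT.
rewrite induced_induced // in ES.
have EU := induced_inj sSV (fsubset_trans sUT sTV) ES.
by rewrite (mx T) // EU.
Qed.

(** * Greedy extension to a maximal P-set *)

Hypothesis Pacc : accessible.
Hypothesis Pglue : glueable.

Definition stable (G : graph) (S : {fset nat}) : bool :=
  all (fun v => (v \in S) || ~~ Pset G (v |` S)) (verts G).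

(** By (A), a P-set with a larger P-set above it can be enlarged by a single vertex. Hence
    maximality is a decidable, local condition. *)
Lemma maxset_stable G S :
  Pmaxset G S <-> [&& S `<=` verts G, Pset G S & stable G S].
Proof.
split=> [[sSV PS mx]|/and3P[sSV PS /allP st]].
  rewrite sSV PS; apply/allP => v vV; apply/orP.
  case: (boolP (Pset G (v |` S))) => [PvS|]; [left|by right].
  by rewrite -(mx _ (fsubsetU1 _ _) _ PvS) ?fset1U1 // fsubUset fsub1set vV.
split=> // T sST sTV PT; apply/eqP; rewrite eq_sym; apply/negPn/negP => neST.
have [v] := Pacc sTV sST neST PT PS; rewrite inE => /andP[vS vT] PvS.
by have := st v (fsubsetP sTV v vT); rewrite (negbTE vS) PvS.
Qed.

Definition grow (G : graph) (l : seq nat) (v : nat) : seq nat :=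
  if v \in l then l else if Pset G [fset x in v :: l] then v :: l else l.
Definition pass (G : graph) (l : seq nat) : seq nat :=
  foldl (grow G) l (sorted_verts G).
(* As [P] need not be hereditary, a vertex rejected during a pass may become
   acceptable later; each pass before the last useful one adds a vertex, so
   that [#|` verts G|] passes suffice. *)
Definition extend (G : graph) (l : seq nat) : seq nat :=
  foldl (fun l _ => pass G l) l (sorted_verts G).

Definition good (G : graph) (l : seq nat) : Prop :=
  [/\ uniq l, {subset l <= verts G} & Pset G [fset x in l]].

Lemma in_fset_seq (v : nat) (l : seq nat) : (v \in [fset x in l]) = (v \in l).
Proof. by rewrite inE. Qed.

Lemma fset_seq_cons (v : nat) l : [fset x in v :: l] = v |` [fset x in l].
Proof. by apply/fsetP => x; rewrite !inE. Qed.

Lemma fset_seq_sub (l : seq nat) (V : {fset nat}) :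
  {subset l <= V} -> [fset x in l] `<=` V.
Proof. by move=> s; apply/fsubsetP => x; rewrite inE => /s. Qed.

Lemma fset_sorted_verts G : [fset x in sorted_verts G] = verts G.
Proof. by apply/fsetP => x; rewrite inE mem_sorted_verts. Qed.

Lemma good_size G l : good G l -> size l <= #|` verts G|.
Proof.
by move=> [ul sl _]; rewrite -size_sorted_verts; apply: uniq_leq_size => // x;
  rewrite mem_sorted_verts; apply: sl.
Qed.

Lemma good_grows G l s : good G l -> {subset s <= verts G} ->
  good G (foldl (grow G) l s).
Proof.
elim: s l => //= v s IHs l gl sV; apply: IHs; last first.
  by move=> x xs; apply: sV; rewrite inE xs orbT.
rewrite /grow; case: ifP => // vl; case: ifP => // PvS; case: gl => ul sl _.
split=> //=; first by rewrite vl.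
by move=> x /predU1P[->|/sl//]; apply: sV; rewrite mem_head.
Qed.

Lemma sub_grow G l v : {subset l <= grow G l v}.
Proof.
by move=> x xl; rewrite /grow; do 2!case: ifP => // _; rewrite inE xl orbT.
Qed.

Lemma sub_grows G l s : {subset l <= foldl (grow G) l s}.
Proof.
by elim: s l => [l x //|v s IHs l x xl] /=; apply: IHs; apply: sub_grow.
Qed.

Lemma size_grow G l v : size l <= size (grow G l v).
Proof. by rewrite /grow; do 2!case: ifP => //= _. Qed.

Lemma size_grows G l s : size l <= size (foldl (grow G) l s).
Proof.
by elim: s l => //= v s IHs l; apply: leq_trans (IHs _); apply: size_grow.
Qed.

(** A pass that does not lengthen the list never changed it, so each vertex was tested against [l]
    itself and rejected. *)
Lemma grows_stuck G l s : size (foldl (grow G) l s) <= size l ->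
  {in s, forall v, (v \in l) || ~~ Pset G (v |` [fset x in l])}.
Proof.
elim: s l => //= v s IHs l; have := size_grows G (grow G l v) s.
rewrite /grow fset_seq_cons -/(grow G); case: ifP => vl.
  by move=> _ le x; rewrite inE => /predU1P[->|/(IHs _ le)//]; rewrite vl.
case: ifP => Pv /=; first by move=> le1 le2; lia.
move=> _ le x; rewrite inE => /predU1P[->|/(IHs _ le)//].
by rewrite Pv orbT.
Qed.

Lemma grows_stable G l s : {subset s <= verts G} -> stable G [fset x in l] ->
  foldl (grow G) l s = l.
Proof.
move=> sV /allP st; elim: s sV => //= v s IHs sV.
suff -> : grow G l v = l.
  by apply: IHs => x xs; apply: sV; rewrite inE xs orbT.
have := st v (sV v (mem_head _ _)); rewrite /grow fset_seq_cons inE.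
by case: ifP => //= _ /negbTE->.
Qed.

Lemma good_pass G l : good G l -> good G (pass G l).
Proof. by move=> gl; apply: good_grows => // x; rewrite mem_sorted_verts. Qed.

Lemma pass_stable_or_grows G l : good G l ->
  stable G [fset x in l] /\ pass G l = l \/ size l < size (pass G l).
Proof.
move=> gl; case: ltnP => [|le]; [by right|left].
have st : stable G [fset x in l].
  apply/allP => v; rewrite -mem_sorted_verts => vV.
  by have := grows_stuck le vV; rewrite in_fset_seq.
by split=> //; apply: grows_stable => // x; rewrite mem_sorted_verts.
Qed.

Lemma passes_spec G l (s : seq nat) (l' := foldl (fun l _ => pass G l) l s) :
  good G l ->
  [/\ good G l', {subset l <= l'}
    & stable G [fset x in l'] \/ size l + size s <= size l'].
Proof.
rewrite {}/l'; elim/last_ind: s => [|s v IHs] gl /=.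
  by split=> //; right; rewrite addn0.
have [gs sls st] := IHs gl; rewrite foldl_rcons size_rcons.
split; first exact: good_pass.
  by move=> x /sls; apply: sub_grows.
have [[st' ->]|lt] := pass_stable_or_grows gs; first by left.
case: st => [st|le]; last by right; lia.
(* A stable list is a fixed point of the pass, so it cannot have grown. *)
by move: lt; rewrite /pass grows_stable ?ltnn // => x; rewrite mem_sorted_verts.
Qed.

Lemma extend_spec G l : good G l ->
  [/\ good G (extend G l), {subset l <= extend G l}
    & Pmaxset G [fset x in extend G l]].
Proof.
move=> gl; have [ge sle st] := passes_spec (sorted_verts G) gl.
split=> //; have [ue se Pe] := ge; apply/maxset_stable.
rewrite fset_seq_sub // Pe; case: st => //= le.
(* In the remaining case the list is as long as the vertex set, so it contains every vertex and is
   trivially stable. *)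
have [||_ Ev] := uniq_min_size ue (s2 := sorted_verts G).
- by move=> x /se; rewrite mem_sorted_verts.
- exact: leq_trans (leq_addl _ _) le.
by apply/allP => v vV; rewrite in_fset_seq Ev mem_sorted_verts vV.
Qed.

Lemma exists_maxset G S : S `<=` verts G -> Pset G S ->
  exists2 M, Pmaxset G M & S `<=` M.
Proof.
move=> /fsubsetP sSV PS.
pose l := sort leq S; have lS x : (x \in l) = (x \in S) by rewrite mem_sort.
have ES : [fset x in l] = S by apply/fsetP => x; rewrite inE lS.
have gl : good G l.
  split; rewrite ?ES ?sort_uniq ?fset_uniq // => x; rewrite lS; exact: sSV.
have [_ se mx] := extend_spec gl.
exists [fset x in extend G l] => //; apply/fsubsetP => x.
by rewrite -lS in_fset_seq; apply: se.
Qed.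

(** This list serves only for counting: its size is the K of the time bound, and no program computes
    it. *)
Definition Pmaxsets (G : graph) : seq {fset nat} :=
  [seq S <- fpowerset (verts G) | Pset G S && stable G S].

Lemma mem_maxsets G S : S \in Pmaxsets G <-> Pmaxset G S.
Proof.
by rewrite mem_filter fpowersetE andbC; apply: iff_sym (maxset_stable _ _).
Qed.

Lemma maxsets_uniq G : uniq (Pmaxsets G).
Proof. by rewrite filter_uniq ?fset_uniq. Qed.

Lemma Pset_induced G S T : T `<=` S -> Pset (induced G S) T = Pset G T.
Proof. by move=> sTS; rewrite /Pset induced_induced. Qed.

(* This is what bounds the number of answers on [G[W]] by that on [G]: a
   maximal [P]-set of [G] extends at most one of them. *)
Lemma maxset_induced_inj G W M T1 T2 v :
  W `<=` verts G -> M `<=` verts G -> Pset G M ->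
  Pmaxset (induced G W) T1 -> Pmaxset (induced G W) T2 ->
  v \in T1 -> v \in T2 -> T1 `<=` M -> T2 `<=` M -> T1 = T2.
Proof.
move=> sWV sMV PM [s1 P1 mx1] [s2 P2 mx2] v1 v2 s1M s2M.
rewrite verts_induced_sub // in s1 mx1 s2 mx2.
rewrite Pset_induced // in P1; rewrite Pset_induced // in P2.
have PU := Pglue sMV s1M s2M PM P1 P2 v1 v2.
have sU : T1 `|` T2 `<=` W by rewrite fsubUset s1.
rewrite -(mx1 (T1 `|` T2)) ?fsubsetUl ?Pset_induced //.
by rewrite (mx2 (T1 `|` T2)) ?fsubsetUr ?Pset_induced.
Qed.

(** Induction on the number of vertices of [S] not yet covered. The member of [F] containing the
    growing set may change at each enlargement. *)
Lemma closed_family_complete G (F : seq {fset nat}) T0 S :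
  T0 `<=` S -> Pset G T0 -> (exists2 H, H \in F & T0 `<=` H) ->
  (forall H v T, H \in F -> v \in verts G -> v \notin H -> T `<=` v |` H ->
     v \in T -> Pset G T -> exists2 H', H' \in F & T `<=` H') ->
  Pmaxset G S -> exists2 H, H \in F & S `<=` H.
Proof.
move=> sT0 PT0 FT0 cl [sSV PS _].
have [k] := ubnP (#|` S `\` T0|); elim: k T0 sT0 PT0 FT0 => // k IHk T sTS PT.
move=> [H FH sTH] /ltnSE lek.
have [<-|neTS] := eqVneq T S; first by exists H.
have [v] := Pacc sSV sTS neTS PS PT; rewrite inE => /andP[vT vS] PvT.
have svT : v |` T `<=` S by rewrite fsubUset fsub1set vS.
apply: (IHk (v |` T)) => //; last first.
  apply: leq_trans lek; apply: fproper_ltn_card.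
  by rewrite fproperD2l // fproperUr // fsub1set.
have [vH|vH] := boolP (v \in H).
  by exists H; rewrite // fsubUset fsub1set vH.
apply: cl FH (fsubsetP sSV v vS) vH _ _ PvT; first exact: fsetUS.
exact: fset1U1.
Qed.

End Hereditary.

(** * The enumeration algorithm *)

Notation enc_list := (enc_seq Atom).
Notation enc_fam := (enc_seq (enc_seq Atom)).

(** * Inclusion tests *)

Definition Subset : prog :=
  Fold Head (Const 1)
    (If (Seq (Pair (Var 0) (Skip 3)) Member) (Var 1) (Const 0)).

Definition subsetc (m : nat) : nat := m.+1 * (memc m + 100).

Lemma run_subset (A B : seq nat) m : size A <= m -> size B <= m ->
  run Subset (Cell (enc_list A) (enc_list B)) (Atom (all (mem B) A))
    (subsetc m).
Proof.
move=> leA leB.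
have -> : all (mem B) A = foldl (fun b x => (x \in B) && b) true A.
  rewrite -[LHS]andbT; elim: A {leA} true => //= x A IHA b.
  by rewrite -IHA andbCA andbA.
have r := @run_foldl _ _ Atom (fun b : bool => Atom b)
  (fun b x => (x \in B) && b) Head (Const 1)
  (If (Seq (Pair (Var 0) (Skip 3)) Member) (Var 1) (Const 0))
  (Cell (enc_list A) (enc_list B)) A true 1 1 (memc m + 50) m.
apply: run_le (r _ _ _ _) _ => //; [exact: run_head|exact: run_const| |].
  move=> l1 x l2 _; eapply run_le.
    apply: (run_ifb (b := x \in B) (t := 10)).
    - by apply: run_seq (run_mem _ leB); run_prim.
    - by move=> ->; apply: run_le (run_var _ _) _.
    - by move=> /negbTE->; apply: run_le (run_const _ _) _.
  by rewrite /=; lia.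
by rewrite /subsetc; lia.
Qed.

(** A set has several lists, so duplicates are detected by inclusion; between maximal P-sets,
    inclusion is equality. *)
Definition Covered : prog :=
  Fold Tail (Const 0)
    (If (Seq (Pair (Var 2) (Var 0)) Subset) (Const 1) (Var 1)).

Definition coveredc (m : nat) : nat := m.+1 * (subsetc m + 100).

Lemma run_covered (A : seq nat) (F : seq (seq nat)) m :
  size A <= m -> size F <= m -> {in F, forall B, size B <= m} ->
  run Covered (Cell (enc_list A) (enc_fam F))
    (Atom (has (fun B => all (mem B) A) F)) (coveredc m).
Proof.
move=> leA leF leB.
have -> : has (fun B => all (mem B) A) F =
    foldl (fun b B => all (mem B) A || b) false F.
  rewrite -[LHS]orbF; elim: F {leF leB} false => //= B F IHF b.
  by rewrite -IHF orbCA orbA.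
have r := @run_foldl _ _ enc_list (fun b : bool => Atom b)
  (fun b B => all (mem B) A || b) Tail (Const 0)
  (If (Seq (Pair (Var 2) (Var 0)) Subset) (Const 1) (Var 1))
  (Cell (enc_list A) (enc_fam F)) F false 1 1 (subsetc m + 50) m.
apply: run_le (r _ _ _ _) _ => //; [exact: run_tail|exact: run_const| |].
  move=> l1 B l2 El.
  have leBm : size B <= m by apply: leB; rewrite El mem_cat mem_head orbT.
  eapply run_le.
    apply: (run_ifb (b := all (mem B) A) (t := 10)).
    - by apply: run_seq (run_subset leA leBm); run_prim.
    - by move=> ->; apply: run_le (run_const _ _) _.
    - by move=> /negbTE->; apply: run_le (run_var _ _) _.
  by rewrite /=; lia.
by rewrite /coveredc; lia.
Qed.

Lemma leq_exp m n e : m <= n -> m ^ e <= n ^ e.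
Proof. by case: e => // e; rewrite leq_exp2r. Qed.

(** * Testing and extending P-sets by programs *)

Section Enumeration.

Variable P : pred graph.
Hypothesis Pacc : accessible P.
Hypothesis Pglue : glueable P.

Variables (pdec : prog) (cd dd : nat).
Hypothesis pdecP : forall G : graph,
  run pdec (enc_graph G) (Atom (P G)) (cd * (#|` verts G| + 1) ^ dd).

Definition Test : prog := Seq Induce pdec.

Definition testc (m : nat) : nat := (inducec m + cd * (m + 1) ^ dd).+1.

Lemma run_test G l m : size l <= m -> #|` verts G| <= m ->
  run Test (Cell (enc_list l) (enc_graph G)) (Atom (Pset P G [fset x in l]))
    (testc m).
Proof.
move=> lel leG; apply: run_seq; first exact: run_induce.
apply: run_le (pdecP _) _; rewrite leq_mul2l leq_exp ?orbT // leq_add2r.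
by apply: leq_trans leG; apply: fsubset_leq_card; apply: fsubsetIl.
Qed.

(* Input: [Cell v (Cell acc (Cell l G))], inside [Pass]. *)
Definition Grow : prog :=
  If (Seq (Pair (Var 0) (Var 1)) Member) (Var 1)
    (If (Seq (Pair (Pair (Var 0) (Var 1)) (Skip 3)) Test)
       (Pair (Var 0) (Var 1)) (Var 1)).

Definition Pass : prog := Fold (Var 1) Head Grow.

Definition passc (m : nat) : nat := m.+1 * (memc m + testc m + 200).

(* The strict inequality leaves room for one more vertex in [l]. *)
Lemma good_size_le G l m : good P G l -> #|` verts G| < m -> size l < m.
Proof. by move=> /good_size; apply: leq_ltn_trans. Qed.

Lemma run_pass G l m : good P G l -> #|` verts G| < m ->
  run Pass (Cell (enc_list l) (enc_graph G)) (enc_list (pass P G l)) (passc m).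
Proof.
move=> gl leG.
have r := @run_foldl _ _ Atom enc_list (grow P G) (Var 1) Head Grow
  (Cell (enc_list l) (enc_graph G)) (sorted_verts G) l 10 10
  (memc m + testc m + 100) m.
apply: run_le (r _ _ _ _) _.
- by apply: run_le (run_var _ _) _.
- by apply: run_le (run_head _) _.
- by rewrite size_sorted_verts ltnW.
- move=> l1 v l2 El; set a := foldl _ _ _.
  have ga : good P G a.
    apply: good_grows => // x xl1; rewrite -mem_sorted_verts El mem_cat.
    by rewrite xl1.
  have lea := good_size_le ga leG.
  have rt : run Test (Cell (enc_list (v :: a)) (enc_graph G))
      (Atom (Pset P G [fset x in v :: a])) (testc m).
    by apply: run_test => //; apply: ltnW.
  rewrite /grow; eapply run_le.
    apply: (run_ifb (b := v \in a) (t := testc m + 50)).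
    - by apply: run_seq (run_mem _ (ltnW lea)); run_prim.
    - by move=> ->; apply: run_le (run_var _ _) _; rewrite /=; lia.
    move=> /negbTE->; eapply run_le.
      apply: (run_ifb (t := 20)).
      - by apply: run_seq rt; run_prim.
      - by move=> ->; eapply run_le; [run_prim|].
      - by move=> /negbTE->; eapply run_le; [run_prim|].
    by rewrite /=; lia.
  by rewrite /=; lia.
by rewrite /passc; lia.
Qed.

Definition Extend : prog :=
  Fold (Var 1) Head (Seq (Pair (Var 1) (Skip 3)) Pass).

Definition extendc (m : nat) : nat := m.+1 * (passc m + 100).

Lemma run_extend G l m : good P G l -> #|` verts G| < m ->
  run Extend (Cell (enc_list l) (enc_graph G)) (enc_list (extend P G l))
    (extendc m).
Proof.
move=> gl leG.
have r := @run_foldl _ _ Atom enc_list (fun l _ => pass P G l) (Var 1) Head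
  (Seq (Pair (Var 1) (Skip 3)) Pass)
  (Cell (enc_list l) (enc_graph G)) (sorted_verts G) l 10 10
  (passc m + 30) m.
apply: run_le (r _ _ _ _) _.
- by apply: run_le (run_var _ _) _.
- by apply: run_le (run_head _) _.
- by rewrite size_sorted_verts ltnW.
- move=> l1 v l2 _; have [ga _ _] := passes_spec l1 gl.
  eapply run_le; first by apply: run_seq (run_pass ga leG); run_prim.
  by rewrite /=; lia.
by rewrite /extendc; lia.
Qed.

(** * Families of maximal P-sets and their closure *)

Definition fam (G : graph) (f : seq (seq nat)) : Prop :=
  {in f, forall l, good P G l /\ Pmaxset P G [fset x in l]} /\
  uniq [seq [fset x in l] | l <- f].

Definition covers (f : seq (seq nat)) (T : {fset nat}) : Prop :=
  exists2 l, l \in f & T `<=` [fset x in l].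

(** One instance, for fixed [H] and [v], of the closure hypothesis of [closed_family_complete]. *)
Definition closed_at (G : graph) f (H : {fset nat}) v : Prop :=
  forall T, T `<=` v |` H -> v \in T -> Pset P G T -> covers f T.

Lemma covers_mono f f' T : {subset f <= f'} -> covers f T -> covers f' T.
Proof. by move=> sub [l lf sT]; exists l => //; apply: sub. Qed.

(** This is why [fam] asks for distinct sets and not merely for distinct lists. *)
Lemma fam_size G f : fam G f -> size f <= size (Pmaxsets P G).
Proof.
move=> [hf uf]; rewrite -(size_map (fun l : seq nat => [fset x in l])).
apply: uniq_leq_size => // _ /mapP[l lf ->]; apply/mem_maxsets => //.
by have [] := hf l lf.
Qed.

(* [w = (q, f)], with [f] the sets found so far and [q] those still to be
   processed. *)
Definition addw (G : graph) (w : seq (seq nat) * seq (seq nat)) (h : graph) :=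
  let l := extend P G (sorted_verts h) in
  if has (fun B => all (mem B) l) w.2 then w else (l :: w.1, l :: w.2).

Definition enc_work (w : seq (seq nat) * seq (seq nat)) : sexp :=
  Cell (enc_fam w.1) (enc_fam w.2).

(* Input: [Cell h (Cell (Cell q f) G)]. *)
Definition Add : prog :=
  Seq (Pair (Seq (Pair (Seq Head Head) (Skip 2)) Extend) (Var 1))
    (If (Seq (Pair Head (Skip 2)) Covered) Tail
       (Pair (Pair Head (Var 1)) (Pair Head (Skip 2)))).

Definition addc (m : nat) : nat := extendc m + coveredc m + 100.

Lemma run_add G w h m :
  good P G (sorted_verts h) -> fam G w.2 ->
  #|` verts G| < m -> size (Pmaxsets P G) <= m ->
  run Add (Cell (enc_graph h) (Cell (enc_work w) (enc_graph G)))
    (enc_work (addw G w h)) (addc m).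
Proof.
move=> gh fw leG leK; rewrite /addw; set l := extend _ _ _.
have [gl _ _] := extend_spec Pacc gh.
have lel := good_size_le gl leG.
have lef : size w.2 <= m by apply: leq_trans (fam_size fw) leK.
have leB : {in w.2, forall B, size B <= m}.
  by move=> B /fw.1[/good_size_le gB _]; apply/ltnW/gB.
eapply run_le.
  apply: (run_seq (y := Cell (enc_list l) (enc_work w))).
    apply: run_pair; last by run_prim.
    by apply: run_seq (run_extend gh leG); run_prim.
  apply: (run_ifb (t := 30)).
  - by apply: run_seq (run_covered (ltnW lel) lef leB); run_prim.
  - by move=> ->; eapply run_le; [run_prim|].
  - by move=> /negbTE->; eapply run_le; [run_prim|].
by rewrite /addc /=; lia.
Qed.

(** The third clause ensures that no new set escapes processing. The equation on sizes, written
    without subtraction, makes the measure of the main loop decrease. *)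
Definition ext (w w' : seq (seq nat) * seq (seq nat)) : Prop :=
  [/\ {subset w.2 <= w'.2}, {subset w.1 <= w'.1},
      {in w'.2, forall l, l \in w.2 \/ l \in w'.1},
      (size w'.2 + size w.1 = size w.2 + size w'.1)%N
    & {subset w.1 <= w.2} -> {subset w'.1 <= w'.2}].

Lemma ext_refl w : ext w w.
Proof. by split=> // l; left. Qed.

Lemma ext_trans w1 w2 w3 : ext w1 w2 -> ext w2 w3 -> ext w1 w3.
Proof.
move=> [f12 q12 n12 s12 i12] [f23 q23 n23 s23 i23]; split; last by auto.
- by move=> l /f12/f23.
- by move=> l /q12/q23.
- by move=> l /n23[/n12[]|]; auto; move=> /q23; auto.
- by lia.
Qed.

Lemma addw_spec G w h (w' := addw G w h) :
  good P G (sorted_verts h) -> fam G w.2 ->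
  [/\ ext w w', fam G w'.2 & covers w'.2 (verts h)].
Proof.
move=> gh fw; rewrite /w' /addw; set l := extend _ _ _.
have [gl sl ml] := extend_spec Pacc gh.
case: ifP => [/hasP[B Bf /allP lB]|/hasPn nc].
  split=> //; first exact: ext_refl.
  exists B => //; apply/fsubsetP => x; rewrite -mem_sorted_verts in_fset_seq.
  by move=> /sl/lB.
split=> /=.
- split=> /=.
  + by move=> x xf; rewrite inE xf orbT.
  + by move=> x xf; rewrite inE xf orbT.
  + by move=> x; rewrite !inE => /predU1P[->|->]; [right; rewrite eqxx|left].
  + by rewrite addSn addnS.
  + by move=> sub x; rewrite !inE => /predU1P[->|/sub->]; rewrite ?eqxx ?orbT.
- split; first by move=> x; rewrite inE => /predU1P[->|/fw.1].
  (* A listed [B] representing the same set as [l] would have passed the inclusion test. *)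
  rewrite /= fw.2 andbT; apply/negP => /mapP[B /nc/allPn[x xl xB] E].
  have : x \in [fset y in B] by rewrite -E in_fset_seq.
  by rewrite in_fset_seq => xB'; case/negP: xB.
exists l; first exact: mem_head.
by apply/fsubsetP => x; rewrite -mem_sorted_verts in_fset_seq; apply: sl.
Qed.

Lemma addws_spec G w hs (w' := foldl (addw G) w hs) :
  {in hs, forall h, good P G (sorted_verts h)} -> fam G w.2 ->
  [/\ ext w w', fam G w'.2 & {in hs, forall h, covers w'.2 (verts h)}].
Proof.
rewrite /w'; elim/last_ind: hs {w'} => [|hs h IHhs] gh fw.
  by split=> //; apply: ext_refl.
have [||e1 f1 c1] := IHhs => //.
  by move=> x xhs; apply: gh; rewrite mem_rcons inE xhs orbT.
have [|e2 f2 c2] := addw_spec _ f1 (h := h).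
  by apply: gh; rewrite mem_rcons mem_head.
rewrite foldl_rcons; split=> //; first exact: ext_trans e1 e2.
move=> x; rewrite mem_rcons inE => /predU1P[->//|/c1].
by apply: covers_mono; case: e2.
Qed.

(** Transfers the answers on (G[W], v) to G: they can be extended in G, there are at most K of them,
    and they cover the P-sets of G inside W that contain v. *)
Lemma io_outputs G W v Hs : W `<=` verts G -> v \in W -> uniq Hs ->
  (forall H, H \in Hs <-> max_Psub P (induced G W) H /\ v \in verts H) ->
  [/\ {in Hs, forall h, good P G (sorted_verts h)},
      size Hs <= size (Pmaxsets P G)
    & forall T, T `<=` W -> v \in T -> Pset P G T ->
        exists2 h, h \in Hs & T `<=` verts h].
Proof.
move=> sWV vW uHs HsP; have EW := verts_induced_sub sWV.
have hT h : h \in Hs ->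
    exists2 T, [/\ Pmaxset P (induced G W) T, v \in T & T `<=` W]
      & h = induced G T /\ verts h = T.
  move=> /HsP[/max_Psub_maxset[T mT Eh] vh].
  have [sT _ _] := mT; rewrite EW in sT.
  rewrite induced_induced // in Eh.
  have Ev : verts h = T.
    by rewrite Eh verts_induced_sub // (fsubset_trans sT).
  by exists T => //; split=> //; rewrite -Ev.
have gh : {in Hs, forall h, good P G (sorted_verts h)}.
  move=> h /hT[T [[_ PT _] _ sT] [_ Eh]]; split.
  - exact: sorted_verts_uniq.
  - by move=> x; rewrite mem_sorted_verts Eh => /(fsubsetP sT)/(fsubsetP sWV).
  - by rewrite fset_sorted_verts Eh -(Pset_induced _ _ sT).
split=> //.
  (* Extension maps the answers to maximal P-sets of G, injectively by [maxset_induced_inj]. *)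
  pose phi h := [fset x in extend P G (sorted_verts h)].
  have mphi h : h \in Hs -> Pmaxset P G (phi h) /\ verts h `<=` phi h.
    move=> /gh/(extend_spec Pacc)[_ sl ml]; split=> //.
    by apply/fsubsetP => x; rewrite -mem_sorted_verts in_fset_seq; apply: sl.
  rewrite -(size_map phi); apply: uniq_leq_size.
    rewrite map_inj_in_uniq // => h1 h2 h1Hs h2Hs E.
    have [[s1 P1 _] sub1] := mphi h1 h1Hs; have [_ sub2] := mphi h2 h2Hs.
    have [T1 [m1 v1 _] [Eh1 E1]] := hT h1 h1Hs.
    have [T2 [m2 v2 _] [Eh2 E2]] := hT h2 h2Hs.
    rewrite Eh1 Eh2; congr induced.
    apply: (maxset_induced_inj Pglue sWV s1 P1 m1 m2 v1 v2); rewrite -?E1 //.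
    by rewrite -E2 E.
  move=> _ /mapP[h hHs ->]; apply/mem_maxsets => //.
  by have [] := mphi h hHs.
move=> T sT vT PT.
(* T extends inside G[W] to a maximal P-set, which still contains v and is therefore an answer. *)
have [||M mM sTM] := @exists_maxset P Pacc (induced G W) T.
- by rewrite EW.
- by rewrite Pset_induced.
have [sM PM _] := mM; rewrite EW in sM.
have EM : verts (induced (induced G W) M) = M by rewrite verts_induced_sub ?EW.
exists (induced (induced G W) M); rewrite ?EM //.
apply/HsP; rewrite EM (fsubsetP sTM) //; split=> //.
by apply/max_Psub_maxset; exists M.
Qed.

(** * Processing one set by means of io-restricted instances *)

Variables (pio : prog) (ci di : nat).
Hypothesis pioP : forall G v, almost_satisfies P G -> v \in verts G ->
  exists Hs,
    [/\ uniq Hs, forall H, H \in Hs <-> max_Psub P G H /\ v \in verts H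
      & run pio (Cell (enc_graph G) (Atom v)) (enc_seq enc_graph Hs)
          (ci * (#|` verts G| + size Hs + 1) ^ di)].

(* Input: [Cell v (Cell acc (Cell (Cell l q) (Cell f G)))], inside [Process],
   whose own input is [Cell (Cell l q) (Cell f G)]. *)
Definition Solve : prog :=
  Fold (Seq (Pair (Seq (Pair (Pair (Var 0) (Seq (Var 2) Head)) (Skip 4)) Induce)
               (Var 0)) pio)
    (Var 1) (Seq (Pair Head (Pair (Var 1) (Skip 6))) Add).

(** One [m] bounds the number of vertices, the other the number of answers. *)
Definition ioc (m : nat) : nat := ci * (m + m + 1) ^ di.

Definition solvec (m : nat) : nat := inducec m + ioc m + m.+1 * (addc m + 200).

Lemma run_solve G l v w m x y :
  good P G l -> v \in verts G -> v \notin l -> fam G w.2 ->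
  #|` verts G| < m -> size (Pmaxsets P G) <= m ->
  exists w',
    [/\ run Solve (Cell (Atom v) (Cell (enc_work w)
               (Cell (Cell (enc_list l) x) (Cell y (enc_graph G)))))
          (enc_work w') (solvec m),
        ext w w', fam G w'.2 & closed_at G w'.2 [fset x in l] v].
Proof.
move=> gl vV vl fw leG leK; have lel := good_size_le gl leG.
have [ul sl Pl] := gl.
pose W := [fset z in v :: l].
have EW : W = v |` [fset z in l] by rewrite /W fset_seq_cons.
have sWV : W `<=` verts G by rewrite EW fsubUset fsub1set vV fset_seq_sub.
have vW : v \in W by rewrite EW fset1U1.
(* Deleting v from G[W] leaves the graph induced by the P-set [l], so the promise holds. *)
have aW : almost_satisfies P (induced G W).
  exists v; first by rewrite verts_induced_sub.
  rewrite /del_vertex verts_induced_sub // induced_induced ?fsubsetDl //.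
  by rewrite EW fsetU1K ?in_fset_seq.
have [|Hs [uHs HsP rHs]] := pioP aW (v := v).
  by rewrite verts_induced_sub.
have [gHs leHs cHs] := io_outputs sWV vW uHs HsP.
exists (foldl (addw G) w Hs); have [e f c] := addws_spec gHs fw.
split=> //; last first.
  move=> T; rewrite -EW => sT vT PT; have [h hHs sTh] := cHs T sT vT PT.
  by have [B Bf sB] := c h hHs; exists B => //; apply: fsubset_trans sB.
set env := Cell (Atom v) _.
have {}rHs : run pio (Cell (enc_graph (induced G W)) (Atom v))
    (enc_seq enc_graph Hs) (ioc m).
  apply: run_le rHs _; rewrite leq_mul2l leq_exp ?orbT // leq_add2r leq_add //.
    by apply: leq_trans (ltnW leG); apply: fsubset_leq_card; apply: fsubsetIl.
  exact: leq_trans leHs leK.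
have rl : run (Seq (Pair (Seq (Pair (Pair (Var 0) (Seq (Var 2) Head)) (Skip 4))
    Induce) (Var 0)) pio) env (enc_seq enc_graph Hs)
    (inducec m + ioc m + 60).
  eapply run_le.
    apply: run_seq; last exact: rHs.
    apply: run_pair; last by apply: run_var.
    apply: run_seq; last by apply: (run_induce (l := v :: l) lel (ltnW leG)).
    by run_prim.
  by rewrite /=; lia.
have ri : run (Var 1) env (enc_work w) 5 by apply: run_var.
have leHm : size Hs <= m by apply: leq_trans leHs leK.
apply: run_le
  (run_foldl (f := addw G) (encA := enc_work) (B := addc m + 50)
     rl ri leHm _) _.
  move=> l1 h l2 El.
  have [||_ f1 _] := @addws_spec G w l1 => //.
    by move=> z zl1; apply: gHs; rewrite El mem_cat zl1.
  have gh : good P G (sorted_verts h).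
    by apply: gHs; rewrite El mem_cat mem_head orbT.
  eapply run_le.
    by apply: run_seq (run_add gh f1 leG leK); run_prim.
  by rewrite /=; lia.
by rewrite /solvec; lia.
Qed.

(** The accumulator starts with the queue already stripped of its head [l], the set being
    processed. *)
Definition Process : prog :=
  Fold (Seq (Skip 2) Head) (Pair (Seq Head Tail) (Var 1))
    (If (Seq (Pair (Var 0) (Seq (Var 2) Head)) Member) (Var 1) Solve).

Definition Step : prog :=
  Seq (Pair Process (Skip 2))
    (Pair (Seq Head Head) (Pair (Seq Head Tail) Tail)).

Definition stepc (m : nat) : nat := m.+1 * (memc m + solvec m + 300).

Definition enc_state (G : graph) (w : seq (seq nat) * seq (seq nat)) : sexp :=
  Cell (enc_fam w.1) (Cell (enc_fam w.2) (enc_graph G)).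

Lemma run_step G l q f m :
  good P G l -> fam G f ->
  #|` verts G| < m -> size (Pmaxsets P G) <= m ->
  exists w',
    [/\ run Step (enc_state G (l :: q, f)) (enc_state G w') (stepc m),
        ext (q, f) w', fam G w'.2
      & forall v, v \in verts G -> v \notin l ->
          closed_at G w'.2 [fset x in l] v].
Proof.
move=> gl ff leG leK; have lel := good_size_le gl leG.
(* The answers of [pio] are only known to exist, so the accumulator is not given as a function of
   the prefix; hence an existential invariant and [run_fold]. *)
pose I (vs : seq nat) a := exists2 w, a = enc_work w
  & [/\ ext (q, f) w, fam G w.2
      & {in vs, forall v, v \notin l -> closed_at G w.2 [fset x in l] v}].
set st := enc_state G (l :: q, f).
have rl : run (Seq (Skip 2) Head) st (enc_list (sorted_verts G)) 20.
  by eapply run_le; [run_prim|].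
have ri : run (Pair (Seq Head Tail) (Var 1)) st (enc_work (q, f)) 20.
  by eapply run_le; [run_prim|].
have leV : size (sorted_verts G) <= m by rewrite size_sorted_verts ltnW.
have I0 : I [::] (enc_work (q, f)).
  by exists (q, f) => //; split=> //; apply: ext_refl.
have hI l1 v l2 a : sorted_verts G = l1 ++ v :: l2 -> I l1 a ->
    exists2 a', run (If (Seq (Pair (Var 0) (Seq (Var 2) Head)) Member) (Var 1)
                       Solve) (Cell (Atom v) (Cell a st)) a'
                  (memc m + solvec m + 100)
              & I (rcons l1 v) a'.
  move=> El [w -> [e fw c]].
  have vV : v \in verts G.
    by rewrite -mem_sorted_verts El mem_cat mem_head orbT.
  have rm : run (Seq (Pair (Var 0) (Seq (Var 2) Head)) Member)
      (Cell (Atom v) (Cell (enc_work w) st)) (Atom (v \in l)) (memc m + 50).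
    eapply run_le; first by apply: run_seq (run_mem v (ltnW lel)); run_prim.
    by rewrite /=; lia.
  have [vl|vl] := boolP (v \in l).
    exists (enc_work w).
      eapply run_le; first apply: run_if rm _; rewrite ?vl /=.
        exact: run_var.
      by rewrite /=; lia.
    exists w => //; split=> // z; rewrite mem_rcons inE => /predU1P[->|/c//].
    by rewrite vl.
  have [w' [r' e' f' c']] :=
    run_solve (enc_fam q) (enc_fam f) gl vV vl fw leG leK.
  exists (enc_work w').
    eapply run_le; first apply: run_if rm _; rewrite ?(negbTE vl) /=.
      exact: r'.
    by lia.
  exists w' => //; split=> //; first exact: ext_trans e e'.
  move=> z; rewrite mem_rcons inE => /predU1P[->//|zl1 zl] T sT zT PT.
  have [sub _ _ _ _] := e'.
  by apply: covers_mono sub _; apply: (c z zl1 zl).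
have [a ra [w Ea [e fw c]]] := run_fold rl ri leV I0 hI.
exists w; split=> // [|v]; last by rewrite -mem_sorted_verts; apply: c.
rewrite Ea in ra; eapply run_le.
  apply: (run_seq (y := Cell (enc_work w) (enc_graph G))); last by run_prim.
  by apply: run_pair ra _; run_prim.
by rewrite /stepc /=; lia.
Qed.

(** * The main loop, started from the least P-set [t0 G] *)

Variables (init : prog) (t0 : graph -> seq nat).
Hypothesis initP : forall G, run init (enc_graph G) (enc_list (t0 G)) 10.
Hypothesis t0_uniq : forall G, uniq (t0 G).
Hypothesis t0_sub : forall G, {subset t0 G <= verts G}.
Hypothesis t0_min : forall G S, S `<=` verts G -> Pset P G S ->
  Pset P G [fset x in t0 G] /\ [fset x in t0 G] `<=` S.

(** Closure is demanded only of sets that have left the queue. Once the queue is empty, the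
    hypotheses of [closed_family_complete] hold. *)
Definition work_inv (G : graph) (w : seq (seq nat) * seq (seq nat)) : Prop :=
  [/\ fam G w.2, {subset w.1 <= w.2}, covers w.2 [fset x in t0 G]
    & forall l v, l \in w.2 -> l \notin w.1 -> v \in verts G -> v \notin l ->
        closed_at G w.2 [fset x in l] v].

Definition Output : prog :=
  Fold (Var 1) (Const 0) (Pair (Seq (Pair (Var 0) (Skip 4)) Induce) (Var 1)).

Definition outputc (m : nat) : nat := m.+1 * (inducec m + 100).

Lemma run_output G w m : {in w.2, forall l, size l <= m} ->
  size w.2 <= m -> #|` verts G| <= m ->
  run Output (enc_state G w)
    (enc_seq enc_graph (rev [seq induced G [fset x in l] | l <- w.2]))
    (outputc m).
Proof.
move=> lel lef leG.
have Ef : rev [seq induced G [fset x in l] | l <- w.2] =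
    foldl (fun s (l : seq nat) => induced G [fset x in l] :: s) [::] w.2.
  by rewrite /rev; elim: w.2 [::] {lel lef} => //= l f IHf s.
rewrite Ef; apply: run_le.
  apply: (run_foldl (enc := enc_list) (B := inducec m + 50) _ _ lef).
  - exact: run_var.
  - exact: run_const.
  move=> l1 l l2 El.
  have leln : size l <= m by apply: lel; rewrite El mem_cat mem_head orbT.
  eapply run_le.
    apply: run_pair; last exact: run_var.
    by apply: run_seq (run_induce leln leG); run_prim.
  by rewrite /=; lia.
by rewrite /outputc /=; lia.
Qed.

(** If [t0 G] is not a P-set then, by (C), there is no P-set at all, and [Const 0] outputs the empty
    list. *)
Definition Main : prog :=
  If (Seq (Pair init Id) Test)
    (Seq (Seq (Pair (Seq (Pair init Id) Extend) Id)
            (Pair (Pair Head (Const 0)) (Pair (Pair Head (Const 0)) Tail)))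
       (Seq (While Head Step) Output))
    (Const 0).

Definition mainc (m : nat) : nat :=
  testc m + extendc m + m.+2 * (stepc m + 2) + outputc m + 100.

(** The third conclusion converts a bound in the number of maximal P-sets into one in the size of
    the output. *)
Lemma run_main G m : #|` verts G| < m -> size (Pmaxsets P G) <= m ->
  exists Hs,
    [/\ uniq Hs, forall H, H \in Hs <-> max_Psub P G H,
        size (Pmaxsets P G) <= size Hs
      & run Main (enc_graph G) (enc_seq enc_graph Hs) (mainc m)].
Proof.
move=> leG leK.
have let0 : size (t0 G) <= #|` verts G|.
  rewrite -size_sorted_verts; apply: uniq_leq_size => // x.
  by rewrite mem_sorted_verts; apply: t0_sub.
have rt : run (Seq (Pair init Id) Test) (enc_graph G)
    (Atom (Pset P G [fset x in t0 G])) (testc m + 20).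
  eapply run_le.
    apply: run_seq; last by apply: (run_test (l := t0 G) (m := m)); lia.
    by apply: run_pair (initP G) _; run_prim.
  by lia.
have [Pt0|nPt0] := boolP (Pset P G [fset x in t0 G]); last first.
  have noS S : ~ Pmaxset P G S.
    by move=> [sSV PS _]; have [Pt _] := t0_min sSV PS; rewrite Pt in nPt0.
  exists [::]; split=> //.
  - by move=> H; split=> // /max_Psub_maxset[S /noS].
  - case E: (Pmaxsets P G) => [|S s] //; case: (noS S).
    by apply/mem_maxsets => //; rewrite E mem_head.
  eapply run_le.
    by apply: run_if rt _; rewrite (negbTE nPt0) /=; apply: run_const.
  by rewrite /mainc; lia.
have gt0 : good P G (t0 G) by split.
have [gl sl ml] := extend_spec Pacc gt0; set l := extend P G (t0 G) in gl sl ml.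
have inv0 : work_inv G ([:: l], [:: l]).
  split=> //=.
  - by split=> // x; rewrite inE => /eqP->.
  - exists l; first exact: mem_head.
    by apply/fsubsetP => x; rewrite !in_fset_seq; apply: sl.
  - by move=> x v ->.
(* A new set raises the queue size and lowers the first term by one each, while every round removes
   one set from the queue. The subtraction is exact by [fam_size]. *)
pose mu (w : seq (seq nat) * seq (seq nat)) :=
  (size (Pmaxsets P G) - size w.2 + size w.1)%N.
have hc w : work_inv G w -> run Head (enc_state G w) (enc_fam w.1) 1.
  by move=> _; apply: run_head.
have hs w : work_inv G w -> truth (enc_fam w.1) -> exists w',
    [/\ run Step (enc_state G w) (enc_state G w') (stepc m), work_inv G w'
      & mu w' < mu w].
  case: w => [[|x q] f] [/= ff sqf cf clf] // _.
  have [gx _] := ff.1 x (sqf x (mem_head _ _)).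
  have [w' [r' e' f' c']] := run_step q gx ff leG leK.
  have [sub subq new sz qf] := e'; exists w'; split=> //; last first.
    by have := fam_size f'; rewrite /mu /=; rewrite /= in sz; lia.
  split=> //.
  - by apply: qf => z /= zq; apply: sqf; rewrite inE zq orbT.
  - exact: covers_mono sub cf.
  (* A set outside the new queue is either [x], just processed, or was processed earlier; its
     closure persists as the family grows. *)
  move=> z v zf' zq' vV vz; have [zx|zx] := eqVneq z x.
    by rewrite zx in vz *; apply: c'.
  have zf : z \in f by case: (new z zf') => // zq; rewrite zq in zq'.
  have zq : z \notin x :: q.
    by rewrite inE (negbTE zx); apply: contra zq' => /subq.
  move=> T sT vT PT; apply: covers_mono sub _.
  exact: (clf z v zf zq vV vz).
have [[q f] [rw [/= ff sqf cf clf] tq]] := run_while hc hs inv0.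
case: q => // in rw sqf clf tq *.
(* Completeness gives a listed set containing S, and it equals S by maximality. *)
have cmp S : Pmaxset P G S -> S \in [seq [fset x in l] | l <- f].
  move=> mS; have [sSV PS mx] := mS; have [_ st0] := t0_min sSV PS.
  have [||H HF sSH] :=
    closed_family_complete Pacc (F := [seq [fset x in l] | l <- f])
      st0 Pt0 _ _ mS.
  - by have [z zf sz] := cf; exists [fset x in z] => //; apply: map_f.
  - move=> _ v T /mapP[z zf ->] vV; rewrite in_fset_seq => vz sT vT PT.
    have [y yf sy] := clf z v zf isT vV vz T sT vT PT.
    by exists [fset x in y] => //; apply: map_f.
  have /mapP[z zf Ez] := HF; have [_ [sz Pz _]] := ff.1 z zf.
  by rewrite -(mx H) // Ez.
have fP z : z \in f -> Pmaxset P G [fset x in z] by case/ff.1.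
exists (rev [seq induced G [fset x in l] | l <- f]); split.
- rewrite rev_uniq (map_comp (induced G) (fun l : seq nat => [fset x in l])).
  rewrite map_inj_in_uniq ?ff.2 // => S T /mapP[y yf ->] /mapP[z zf ->].
  by apply: induced_inj; [have [] := fP y yf|have [] := fP z zf].
- move=> H; rewrite mem_rev; split=> [/mapP[z zf ->]|].
    by apply/max_Psub_maxset; exists [fset x in z] => //; apply: fP.
  by move=> /max_Psub_maxset[S /cmp/mapP[z zf ->] ->]; apply: map_f.
- rewrite size_rev size_map -(size_map (fun l : seq nat => [fset x in l])).
  by apply: uniq_leq_size (maxsets_uniq P G) _ => S /mem_maxsets-/(_ Pacc)/cmp.
have ro := @run_output G ([::], f) m.
eapply run_le.
  apply: run_if rt _; rewrite Pt0 /=.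
  apply: (run_seq (y := enc_state G ([:: l], [:: l]))).
    apply: (run_seq (y := Cell (enc_list l) (enc_graph G))); last by run_prim.
    apply: run_pair; last exact: run_id.
    apply: run_seq (run_extend gt0 leG).
    by apply: run_pair (initP G) _; run_prim.
  apply: run_seq rw _; apply: ro => /=.
  - by move=> z /ff.1[/good_size_le gz _]; apply/ltnW/gz.
  - by apply: leq_trans (fam_size ff) leK.
  - exact: ltnW.
rewrite /mainc /mu /=.
(* Queue and family start with one set each, so the initial measure is K - 1 + 1, at most m + 1 even
   for truncated subtraction. *)
have : (size (Pmaxsets P G) - 1 + 1).+1 * (1 + stepc m + 1) <=
  m.+2 * (stepc m + 2).
  by apply: leq_mul; lia.
by lia.
Qed.

End Enumeration.

(** * Polynomial bounds *)

Definition poly_bounded (f : nat -> nat) : Prop :=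
  exists c d, forall m, 0 < m -> f m <= c * m ^ d.

Lemma poly_bounded_const k : poly_bounded (fun=> k).
Proof. by exists k, 0 => m _; rewrite muln1. Qed.

Lemma poly_bounded_id : poly_bounded id.
Proof. by exists 1, 1 => m _; rewrite mul1n. Qed.

(** For positive m the power m ^ d is monotone in d, so raising both exponents to [d + d'] gives a
    single monomial. *)
Lemma poly_bounded_add f g :
  poly_bounded f -> poly_bounded g -> poly_bounded (fun m => (f m + g m)%N).
Proof.
move=> [c [d fP]] [c' [d' gP]]; exists (c + c')%N, (d + d')%N => m m0.
rewrite mulnDl leq_add //.
  by apply: leq_trans (fP m m0) _; rewrite leq_mul2l leq_pexp2l ?leq_addr ?orbT.
by apply: leq_trans (gP m m0) _; rewrite leq_mul2l leq_pexp2l ?leq_addl ?orbT.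
Qed.

Lemma poly_bounded_mul f g :
  poly_bounded f -> poly_bounded g -> poly_bounded (fun m => (f m * g m)%N).
Proof.
move=> [c [d fP]] [c' [d' gP]]; exists (c * c')%N, (d + d')%N => m m0.
by rewrite expnD mulnACA leq_mul ?fP ?gP.
Qed.

Lemma poly_bounded_succ f : poly_bounded f -> poly_bounded (fun m => (f m).+1).
Proof.
move=> pf; have [c [d h]] := poly_bounded_add pf (poly_bounded_const 1).
by exists c, d => m m0; rewrite -addn1; apply: h.
Qed.

Lemma poly_bounded_exp f k :
  poly_bounded f -> poly_bounded (fun m => (f m ^ k)%N).
Proof.
move=> pf; elim: k => [|k IHk]; first exact: (poly_bounded_const 1).
have [c [d h]] := poly_bounded_mul pf IHk.
by exists c, d => m m0; rewrite expnS; apply: h.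
Qed.

Lemma poly_bounded_mainc cd dd ci di : poly_bounded (mainc cd dd ci di).
Proof.
rewrite /mainc /outputc /stepc /solvec /addc /extendc /passc /testc /ioc.
rewrite /coveredc /subsetc /inducec /filterc /memc.
repeat first
  [ apply: poly_bounded_const | apply: poly_bounded_id
  | apply: poly_bounded_add | apply: poly_bounded_mul
  | apply: poly_bounded_succ | apply: poly_bounded_exp ].
Qed.

(* The program starts from the least [P]-set: the empty set in the connected
   case, the root in the rooted case. *)
Lemma least_Pset (P : pred graph) :
  connected_hereditary P \/ rooted_hereditary P ->
  exists (init : prog) (t0 : graph -> seq nat),
    [/\ forall G, run init (enc_graph G) (enc_seq Atom (t0 G)) 10,
        forall G, uniq (t0 G), forall G, {subset t0 G <= verts G}
      & forall G S, S `<=` verts G -> Pset P G S ->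
          Pset P G [fset x in t0 G] /\ [fset x in t0 G] `<=` S].
Proof.
case=> hP; last first.
  exists (Skip 2), (fun G => seq_of_opt (groot G)); split.
  - move=> G; apply: run_le.
      have -> : enc_seq Atom (seq_of_opt (groot G)) =
        skip_sexp 2 (enc_graph G) by rewrite /=; case: (groot G).
      exact: run_skip.
    by [].
  - by move=> G; case: (groot G).
  - move=> [[[V E] [r|]] /= wfG] x; rewrite ?inE // => /eqP->.
    by have /andP[] := wfG.
  - by move=> G S; apply: rooted_her_root.
exists (Const 0), (fun=> [::]); split=> //.
  by move=> G; apply: run_le (run_const _ _) _.
move=> G S sSV PS.
have -> : [fset x in [::]] = fset0 :> {fset nat}.
  by apply/fsetP => x; rewrite inE.
by rewrite fsub0set; split=> //; apply: connected_her_fset0 sSV PS.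
Qed.

Theorem theorem6p2 (P : pred graph)
  (P_nonempty : exists G, P G)
  (P_poly : poly_time_decidable P)
  (P_her : connected_hereditary P \/ rooted_hereditary P) :
  io_restricted_tpt P -> maximal_Psubgraphs_tpt P.
Proof.
move=> [pio [ci [di pioP]]]; have [pdec [cd [dd pdecP]]] := P_poly.
have Pacc : accessible P.
  case: P_her; first exact: connected_her_accessible.
  exact: rooted_her_accessible.
have Pglue : glueable P.
  case: P_her; first exact: connected_her_glueable.
  exact: rooted_her_glueable.
have [init [t0 [initP t0_uniq t0_sub t0_min]]] := least_Pset P_her.
have ioP G v : almost_satisfies P G -> v \in verts G -> exists Hs,
    [/\ uniq Hs, forall H, H \in Hs <-> max_Psub P G H /\ v \in verts H
      & run pio (Cell (enc_graph G) (Atom v)) (enc_seq enc_graph Hs)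
          (ci * (#|` verts G| + size Hs + 1) ^ di)].
  move=> aG vG; have [Hs [t [uHs HsP ev le]]] := pioP (G, v) (conj aG vG).
  by exists Hs; split=> //; exists t.
have [c [d mcP]] := poly_bounded_mainc cd dd ci di.
exists (Main pdec pio init), c, d => G _.
(* The final 1 makes the number of vertices strictly less than m and keeps m positive. *)
pose m := (#|` verts G| + size (Pmaxsets P G) + 1)%N.
have [||Hs [uHs HsP leHs [t ev le]]] := run_main (m := m) (G := G)
  Pacc Pglue pdecP ioP initP t0_uniq t0_sub t0_min.
- by rewrite /m addn1 ltnS leq_addr.
- by rewrite /m -addnA addnCA leq_addr.
exists Hs, t; split=> //; apply: leq_trans le _.
have m0 : 0 < m by rewrite /m addn1.
apply: leq_trans (mcP m m0) _; rewrite leq_mul2l leq_exp ?orbT //.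
by rewrite leq_add2r leq_add2l.
Qed.
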